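(* Let $(X,\tau)$ be a non-degenerate Suslinean chainable continuum. Then, for any ultrafilter order $\leq_{\mathcal{U}}^{\mathcal{D}}$ on $X$, the linearly ordered set $(X,\leq_{\mathcal{U}}^{\mathcal{D}})$ is order isomorphic to $([0,1],\leq)$. Moreover, there exists an order isomorphism $h\colon(X,\leq_{\mathcal{U}}^{\mathcal{D}})\to([0,1],\leq)$ which is a Borel isomorphism of the class $(1,1)$ between $(X,\tau)$ and $([0,1],\tau_e)$, where $\tau_e$ is the Euclidean topology.
   Context: A continuum is a compact connected metrizable space; fix a metric generating its topology. A chain in $X$ is a finite sequence of open sets $d_1,\dots,d_k$ (its links) with $d_i\cap d_j\neq\varnothing\iff|i-j|\le 1$; its mesh is the maximum of the diameters of its links. $X$ is chainable if for every $\varepsilon>0$ it is covered by a chain of mesh less than $\varepsilon$. $\mathbb{N}=\{1,2,3,\dots\}$. Let $\mathcal{D}=\{D_n\}_{n\in\mathbb{N}}$ be a sequence of chains $D_n=\{d_{1,n},\dots,d_{k_n,n}\}$, each covering $X$, with $\mathrm{mesh}(D_n)\to 0$, and let $\mathcal{U}$ be a non-principal ultrafilter on $\mathbb{N}$. Write $x\leq_{D_n}y$ iff there exist $i\le j\le k_n$ with $x\in d_{i,n}$ and $y\in d_{j,n}$, and $x\leq_{\mathcal{U}}^{\mathcal{D}}y$ iff $\{n\in\mathbb{N}: x\leq_{D_n}y\}\in\mathcal{U}$. This is a linear order on $X$. An ultrafilter order on $X$ is any order of the form $\leq_{\mathcal{U}}^{\mathcal{D}}$ for some such $\mathcal{D}$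 and $\mathcal{U}$. A continuum is Suslinean if any collection of its pairwise disjoint nondegenerate (more than one point) subcontinua is countable. A Borel isomorphism $h$ between metrizable spaces is of the class $(1,1)$ if both $h$ and $h^{-1}$ are of the first Baire class, i.e. inverse images of open sets under $h$ and under $h^{-1}$ are $F_\sigma$-sets. *)

(* Defs.v *)
From HB Require Import structures.
From mathcomp Require Import all_boot all_order all_algebra.
From mathcomp Require Import all_classical all_reals all_analysis.
From mathcomp Require Import borel_hierarchy.

Set Implicit Arguments.
Unset Strict Implicit.
Unset Printing Implicit Defensive.

Import Order.TTheory GRing.Theory Num.Theory.
Import numFieldNormedType.Exports.

Local Open Scope classical_set_scope.
Local Open Scope ring_scope.

Section continua.
Context {R : realType} {X : metricType R}.
Implicit Types (A : set X) (s : seq (set X)).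

Definition continuum A := compact A /\ connected A.

Definition nondegenerate_set A := exists x y, [/\ A x, A y & x <> y].

Definition suslinean :=
  forall C : set (set X),
    (forall A, C A -> continuum A /\ nondegenerate_set A) ->
    trivIset C id ->
    countable C.

(* The supremum is taken in \bar R: the diameter of an unbounded set is +oo
   and that of set0 is -oo. *)
Definition diameter A : \bar R :=
  ereal_sup [set (mdist p.1 p.2)%:E | p in A `*` A].

(* Links are numbered from 0. The case i = j of the second clause forces every
   link to be nonempty. *)
Definition chain s :=
  (forall i, (i < size s)%N -> open (nth set0 s i)) /\
  (forall i j, (i < size s)%N -> (j < size s)%N ->
     nth set0 s i `&` nth set0 s j !=set0 <-> (`|i - j| <= 1)%N).

Definition mesh s : \bar R := \big[maxe/-oo%E]_(A <- s) diameter A.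

Definition covers s :=
  forall x : X, exists2 i, (i < size s)%N & nth set0 s i x.

Definition chainable :=
  forall e : R, 0 < e -> exists s, [/\ chain s, covers s & (mesh s < e%:E)%E].

Definition chain_le s (x y : X) :=
  exists i j, [/\ (i <= j < size s)%N, nth set0 s i x & nth set0 s j y].

Definition ultrafilter_le (D : nat -> seq (set X)) (U : set_system nat)
  (x y : X) := U [set n | chain_le (D n) x y].

End continua.
Arguments suslinean {R} X.
Arguments chainable {R} X.

Definition nonprincipal (T : Type) (U : set_system T) :=
  forall t : T, U <> principal_filter t.

Definition order_isomorphism (S T : Type) (leS : S -> S -> Prop)
    (leT : T -> T -> Prop) (h : S -> T) :=
  bijective h /\ forall x y, leS x y <-> leT (h x) (h y).

Definition order_isomorphic (S T : Type) (leS : S -> S -> Prop)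
    (leT : T -> T -> Prop) :=
  exists h : S -> T, order_isomorphism leS leT h.

Section borel_isomorphisms.
Context {S T : topologicalType}.

Definition borel_map (f : S -> T) :=
  forall B, <<s @open T >> B -> <<s @open S >> (f @^-1` B).

Definition first_baire_class (f : S -> T) :=
  forall V, open V -> Fsigma (f @^-1` V).

End borel_isomorphisms.

Definition borel_isomorphism11 (S T : topologicalType) (h : S -> T) :=
  exists g : T -> S,
    [/\ cancel h g, cancel g h,
        borel_map h /\ borel_map g &
        first_baire_class h /\ first_baire_class g].

(* As a type, a set carries its subspace topology. *)
Notation unit_interval R := (set_type (`[0%R, 1%R]%classic : set R)).

Definition unit_interval_le (R : realType) (s t : unit_interval R) : Prop :=
  (set_val s : R) <= set_val t.

(* Main.v *)
From HB Require Import structures.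
Require Import Defs.
From mathcomp Require Import all_boot all_order all_algebra.
From mathcomp Require Import all_classical all_reals all_analysis.
From mathcomp Require Import borel_hierarchy.
From mathcomp Require Import zify lra.
Import Order.TTheory GRing.Theory Num.Theory.
Import numFieldNormedType.Exports.
Local Open Scope classical_set_scope.
Local Open Scope ring_scope.

(** The proof extracts from the chains three facts about the ultrafilter order
    and combines them with hereditary decomposability, which the Suslinean
    condition gives.

    - The order is linear (ultrafilter_le_linear).
    - Subcontinua are order convex (continuum_convex): a connected set that
      meets two links of a chain meets all the links between them, so a point
      lying between two points of a continuum A is arbitrarily close to A.
    - The intersection of two subcontinua is connected
      (chain_hereditarily_unicoherent), so any two points x, y lie in a
      smallest subcontinuum, called hull x y below.
    - Every nondegenerate subcontinuum is a union of two proper subcontinua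
      (suslinean_decomposable): an indecomposable continuum has uncountably
      many composants by Baire's argument, these are pairwise disjoint, and
      each of them contains a nondegenerate continuum.

    Decomposability and convexity act together in hull_split: for x <> y the
    hull of x and y is the union of a continuum P containing x but not y and a
    continuum Q containing y but not x, and P and Q meet. A common point lies
    strictly between x and y, and refining the splitting yields a nondegenerate
    continuum strictly between x and y (interval_continuum). A gap of the order
    would produce a minimal continuum among those that are closed towards the
    gap, and by convexity this continuum could not be decomposed (no_gap); so
    every set has a least upper bound. Small disjoint subcontinua, of which
    there are only countably many, give a countable order-dense set through
    their suprema and infima (countable_order_dense). The order is therefore
    that of [0, 1], by a dyadic version of Cantor's theorem
    (order_isomorphic_unit_interval).

    For the class of the isomorphism, an open ray below x is the union of the
    composants of points of the countable dense set relative to x, hence an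
    F_sigma set (lower_ray_Fsigma). In the other direction, every neighbourhood
    of a point w contains the hull of w and some other point (hull_in_open),
    since otherwise the limit of the hulls from the left of w, which has no
    point below w (hull_left_limit), would include the limit from the right,
    which would have one. Hence an open set corresponds to a set of reals that
    contains with each point a one-sided neighbourhood of it, and such a set is
    a countable union of intervals (Fsigma_one_sided). *)

Set Implicit Arguments.
Unset Strict Implicit.
Unset Printing Implicit Defensive.

(** * Connected and compact sets *)

Section connectedness.
Context {T : topologicalType}.
Implicit Types A S G H : set T.

Lemma connected_open_split A G H : connected A -> open G -> open H ->
  A `<=` G `|` H -> A `&` G !=set0 -> A `&` H !=set0 ->
  A `&` (G `&` H) !=set0.
Proof.
move=> cA oG oH AGH AG [y [Ay Hy]]; apply: contrapT => nGH.
have AE : A `&` G = A `&` ~` H.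
  apply/seteqP; split=> x [Ax Gx]; split => //.
    by move=> Hx; apply: nGH; exists x.
  by have [] := AGH x Ax.
have eqA : A `&` G = A.
  apply: cA => //; first by exists G.
  by exists (~` H) => //; exact: open_closedC.
by apply: nGH; exists y; split => //; split => //; move: Ay; rewrite -eqA => -[].
Qed.

Lemma connected_closed_split A S1 S2 : connected A -> closed S1 -> closed S2 ->
  A `<=` S1 `|` S2 -> A `&` S1 !=set0 -> A `&` S2 !=set0 ->
  A `&` (S1 `&` S2) !=set0.
Proof.
move=> cA cS1 cS2 AS [x [Ax Sx]] [y [Ay Sy]]; apply: contrapT => nS.
have [|||z [Az [nz1 nz2]]] := connected_open_split cA (closed_openC cS1)
  (closed_openC cS2).
- move=> z Az; apply/not_andP => -[z1 z2]; apply: nS; exists z; split => //.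
- by exists y; split => // Sy'; apply: nS; exists y.
- by exists x; split => // Sx'; apply: nS; exists x.
- by have [] := AS z Az.
Qed.

End connectedness.

Section compact_hausdorff.
Context {T : topologicalType}.
Hypotheses (hT : hausdorff_space T) (cT : compact [set: T]).
Implicit Types (A M O : set T) (F : set (set T)).

Lemma closed_compactT A : closed A -> compact A.
Proof. by move=> cA; apply: subclosed_compact cA cT _. Qed.

Definition directed F := forall A B, F A -> F B ->
  exists2 C, F C & C `<=` A `&` B.

(** If no member of F fits into the open set O, the traces of the members outside
    O generate a filter; a cluster point of it lies in every member of F and yet
    not in O. *)
Lemma directed_bigcap_open F O : F !=set0 -> directed F ->
  (forall A, F A -> closed A) -> open O -> \bigcap_(A in F) A `<=` O ->
  exists2 A, F A & A `<=` O.
Proof.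
move=> [A0 FA0] dF clF oO capO; apply: contrapT => nF.
have FF : Filter (filter_from F (fun A => A `\` O)).
  apply: filter_from_filter; first by exists A0.
  move=> A B FA FB; have [C FC CAB] := dF _ _ FA FB.
  by exists C => // x [Cx nOx]; have [] := CAB x Cx.
have PF : ProperFilter (filter_from F (fun A => A `\` O)).
  apply: filter_from_proper => A FA; apply/set0P/eqP => AO; apply: nF.
  by exists A => // x Ax; apply: contrapT => nOx; have : set0 x by rewrite -AO.
have [|p [_ clp]] := cT PF; first by exists A0.
have /clF clO : F A0 by [].
suff : O p.
  move=> Op; have := clp (A0 `\` O) O; case.
  - by exists A0.
  - exact: open_nbhs_nbhs.
  - by move=> x [[]].
apply: capO => A FA; rewrite (closure_id A).1; last exact: clF.
move=> B nB; have [|x [[Ax _] Bx]] := clp (A `\` O) B _ nB; first by exists A.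
by exists x.
Qed.

Lemma directed_bigcap_nonempty F : F !=set0 -> directed F ->
  (forall A, F A -> closed A) -> (forall A, F A -> A !=set0) ->
  \bigcap_(A in F) A !=set0.
Proof.
move=> F0 dF clF neF; apply: contrapT => /nonemptyPn cap0.
have [|A FA A0] := directed_bigcap_open F0 dF clF open0; first by rewrite cap0.
by have [x /A0] := neF A FA.
Qed.

(** Separating a closed set by ambient open sets is what makes disconnectedness
    persist: whatever is included in the union of the two open sets and meets
    both is disconnected too. The proof uses normality. *)
Lemma disconnected_open_split M : closed M -> ~ connected M ->
  exists G H, [/\ open G, open H, G `&` H = set0, M `<=` G `|` H &
    M `&` G !=set0 /\ M `&` H !=set0].
Proof.
move=> clM /connectedPn[E [E0 ME [sE1 sE2]]].
have ME' x : M x <-> E false x \/ E true x by rewrite ME.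
have clEf : closed (E false).
  move=> x cx; have /ME'[//|Etx] : M x.
    by apply: clM; apply: closureS cx => y Ey; apply/ME'; left.
  by exfalso; have : set0 x by rewrite -sE1.
have clEt : closed (E true).
  move=> x cx; have /ME'[Efx|//] : M x.
    by apply: clM; apply: closureS cx => y Ey; apply/ME'; right.
  by exfalso; have : set0 x by rewrite -sE2.
have nT := compact_normal hT cT.
have snb : set_nbhs (E false) (~` E true).
  apply/set_nbhsP; exists (~` E true); split => //; first exact: closed_openC.
  move=> x Efx Etx; have : set0 x by rewrite -sE1; split=> //; exact: subset_closure.
  by [].
have [D /set_nbhsP[G [oG EG GD]] clD] := nT _ clEf _ snb.
have [x Ex] := E0 false; have [y Ey] := E0 true.
exists G, (~` closure D); split => //.
- by apply: closed_openC; exact: closed_closure.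
- by apply/seteqP; split => // z [/GD/subset_closure Dz] /(_ Dz).
- move=> z /ME'[/EG|Etz]; first by left.
  by right => /clD /(_ Etz).
- split; first by exists x; split; [apply/ME'; left|exact: EG].
  by exists y; split; [apply/ME'; right|move=> /clD /(_ Ey)].
Qed.

(** Two open sets that split the intersection already contain, and hence split, a
    member of the family. *)
Lemma directed_bigcap_connected F : F !=set0 -> directed F ->
  (forall A, F A -> closed A) -> (forall A, F A -> connected A) ->
  connected (\bigcap_(A in F) A).
Proof.
move=> F0 dF clF coF; apply: contrapT => nco.
have clM : closed (\bigcap_(A in F) A) by exact: closed_bigI.
have [G [H [oG oH GH MGH [[x [Mx Gx]] [y [My Hy]]]]]] :=
  disconnected_open_split clM nco.
have [|A FA AGH] := directed_bigcap_open F0 dF clF _ MGH; first exact: openU.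
have [||z [_]] := connected_open_split (coF A FA) oG oH AGH.
- by exists x; split => //; exact: Mx.
- by exists y; split => //; exact: My.
- by rewrite GH.
Qed.

(** The coincidence of components and quasi-components in compact Hausdorff
    spaces: the intersection of the relatively clopen subsets of M containing y
    is connected, so it is the component of y, and one of the clopen sets already
    fits into O. *)
Lemma component_clopen_neighbourhood M O y : closed M -> M y -> open O ->
  connected_component M y `<=` O ->
  exists N, [/\ N y, N `<=` M, N `<=` O, closed N & closed (M `\` N)].
Proof.
move=> clM My oO CO.
pose F := [set N | [/\ N y, N `<=` M, closed N & closed (M `\` N)]].
have F0 : F !=set0.
  by exists M; split => //; rewrite setDv; exact: closed0.
have dF : directed F.
  move=> A B [Ay AM clA clA'] [By BM clB clB']; exists (A `&` B) => //.
  split => //; first by move=> x [/AM].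
    exact: closedI.
  rewrite setDIr; exact: closedU.
have clF A : F A -> closed A by case.
have conQ : connected (\bigcap_(A in F) A).
  apply: contrapT => nco; have clQ : closed (\bigcap_(A in F) A) by exact: closed_bigI.
  have [G [H [oG oH GH QGH QQ]]] := disconnected_open_split clQ nco.
  wlog Gy : G H oG oH GH QGH QQ / G y.
    move=> wl; have [|Gy|Hy] := QGH y; first by move=> A [].
      exact: (wl G H).
    by case: QQ => QG QH; apply: (wl H G) => //; rewrite (setIC, setUC).
  case: QQ => _ [x [Qx Hx]].
  have [|N FN NGH] := directed_bigcap_open F0 dF clF _ QGH; first exact: openU.
  have [Ny NM clN clN'] := FN.
  have NG : N `&` G = N `\` H.
    apply/seteqP; split => z [Nz Gz]; split => //.
      by move=> Hz; have : set0 z by rewrite -GH.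
    by have [] := NGH z Nz.
  have : (N `&` G) x.
    apply: Qx; split => //; first by move=> z [/NM].
      by rewrite NG; apply: closedI => //; exact: open_closedC.
    rewrite setDIr setUC.
    by apply: closedU => //; apply: closedI => //; exact: open_closedC.
  by move=> [_ Gx]; have : set0 x by rewrite -GH.
have QO : \bigcap_(A in F) A `<=` O.
  apply: subset_trans CO; apply: connected_component_max => //.
    by move=> A [].
  by move=> x; apply; split => //; rewrite setDv; exact: closed0.
by have [N [Ny NM clN clN'] NO] := directed_bigcap_open F0 dF clF oO QO; exists N.
Qed.

Lemma regular_nbhs O y : open O -> O y ->
  exists V, [/\ open V, V y & closure V `<=` O].
Proof.
move=> oO Oy; have nbT : nbhs y [set: T] by exact: filterT.
have nO : nbhs y O by exact: open_nbhs_nbhs.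
have [V nV clV] := compact_regular hT cT nbT nO.
exists V°; split; [exact: open_interior|exact: nV|].
by apply: subset_trans clV; apply: closureS; exact: interior_subset.
Qed.

(** Baire's theorem inside the closed set M, obtained by intersecting a decreasing
    sequence of closures of open sets that meet M and avoid the F n one by one. *)
Lemma avoid_countable_nowhere_dense M (F : nat -> set T) : closed M -> M !=set0 ->
  (forall n, closed (F n)) ->
  (forall n O, open O -> M `&` O !=set0 -> exists2 y, (M `&` O) y & ~ F n y) ->
  exists2 y, M y & forall n, ~ F n y.
Proof.
move=> clM [x0 Mx0] clF ndF.
have step (nO : nat * set T) : exists V, open nO.2 -> M `&` nO.2 !=set0 ->
    [/\ open V, M `&` V !=set0, closure V `<=` nO.2 & closure V `&` F nO.1 = set0].
  case: nO => n O /=; have [[oO MO]|no] := pselect (open O /\ M `&` O !=set0); last first.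
    by exists O => oO MO; exfalso; apply: no.
  have [y [My Oy] nFy] := ndF n O oO MO.
  have [|//|V [oV Vy clV]] := @regular_nbhs (O `\` F n) y.
    by apply: openI => //; exact: closed_openC.
  exists V => _ _; split => //; first by exists y.
    by move=> z /clV[].
  by apply/seteqP; split => // z [/clV[]].
have [f fP] := choice step.
pose G := fix G n := if n is m.+1 then f (m, G m) else [set: T].
have GP n : open (G n) /\ M `&` G n !=set0.
  elim: n => [|n [oG MG]]; first by split; [exact: openT|exists x0].
  by have [] := fP (n, G n) oG MG.
have GS n : closure (G n.+1) `<=` G n /\ closure (G n.+1) `&` F n = set0.
  by have [oG MG] := GP n; have [] := fP (n, G n) oG MG.
have Gle m n : (m <= n)%N -> G n `<=` G m.
  elim: n => [|n IH]; first by rewrite leqn0 => /eqP ->.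
  rewrite leq_eqVlt => /orP[/eqP ->//|/IH GG].
  by apply: subset_trans GG; apply: subset_trans (GS n).1; exact: subset_closure.
pose C := [set M `&` closure (G n) | n in [set: nat]].
have [||||y yP] := @directed_bigcap_nonempty C.
- by exists (M `&` closure (G 0)); exists 0%N.
- move=> _ _ [m _ <-] [n _ <-]; exists (M `&` closure (G (maxn m n))).
    by exists (maxn m n).
  move=> z [Mz Gz]; split; split => //; move: Gz; apply: closureS; apply: Gle.
    exact: leq_maxl.
  exact: leq_maxr.
- by move=> _ [n _ <-]; apply: closedI => //; exact: closed_closure.
- move=> _ [n _ <-]; have [_ [z [Mz Gz]]] := GP n; exists z; split => //.
  exact: subset_closure.
exists y; first by have [] := yP (M `&` closure (G 0)) (ex_intro2 _ _ 0%N I erefl).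
move=> n Fy; have [_ Gy] := yP (M `&` closure (G n.+1)) (ex_intro2 _ _ n.+1 I erefl).
by have : set0 y by rewrite -(GS n).2.
Qed.

End compact_hausdorff.


(** * Continua and their decompositions *)

Section decomposability.
Context {R : realType} {X : metricType R}.
Hypothesis cX : compact [set: X].
Implicit Types (A K P Q Y O : set X).

Let hX : hausdorff_space X := metric_hausdorff (T:=X).

Definition decomposable Y := exists P Q,
  [/\ continuum P, continuum Q, Y = P `|` Q, P <> Y & Q <> Y].

Lemma continuum_closed A : continuum A -> closed A.
Proof. by move=> [cA _]; exact: compact_closed. Qed.

Lemma continuumP A : closed A -> connected A -> continuum A.
Proof. by move=> clA coA; split => //; exact: closed_compactT. Qed.

Lemma continuumU A K : continuum A -> continuum K -> A `&` K !=set0 ->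
  continuum (A `|` K).
Proof.
move=> cA cK AK; apply: continuumP; first by apply: closedU; exact: continuum_closed.
by apply: connectedU => //; [case: cA|case: cK].
Qed.

Lemma component_continuum A y : closed A -> continuum (connected_component A y).
Proof.
by move=> clA; apply: continuumP; [exact: component_closed|exact: component_connected].
Qed.

Lemma proper_subset_ex A K : A `<=` K -> A <> K -> exists2 x, K x & ~ A x.
Proof.
move=> AK nAK; apply: contrapT => nx; apply: nAK; apply/seteqP; split => // x Kx.
by apply: contrapT => nAx; apply: nx; exists x.
Qed.

Lemma nondegenerate_neq Y y : nondegenerate_set Y -> exists2 p, Y p & p <> y.
Proof.
move=> [a [b [Ya Yb ab]]]; have [ay|ay] := pselect (a = y); last by exists a.
by exists b => // yb; apply: ab; rewrite ay yb.
Qed.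

Lemma metric_closed_set1 (p : X) : closed [set p].
Proof. exact/accessible_closed_set1/hausdorff_accessible. Qed.

(** The component of y in the trace on Y of a closed neighbourhood of y inside O
    is nondegenerate: if it were reduced to y, a small clopen neighbourhood of y
    in the trace would be clopen in Y. *)
Lemma boundary_bumping Y O y : continuum Y -> nondegenerate_set Y ->
  open O -> Y y -> O y ->
  exists K, [/\ continuum K, nondegenerate_set K, K y, K `<=` Y & K `<=` O].
Proof.
move=> cY ndY oO Yy Oy.
have clY := continuum_closed cY.
have [p Yp py] := nondegenerate_neq y ndY.
have clp := @metric_closed_set1 p.
have [||V [oV Vy clV]] := regular_nbhs hX cX (O := O `&` ~` [set p]) (y := y).
- by apply: openI => //; exact: closed_openC.
- by split => // yp; apply: py.
pose M := Y `&` closure V.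
have clM : closed M by apply: closedI => //; exact: closed_closure.
have My : M y by split => //; exact: subset_closure.
pose C := connected_component M y.
have CM : C `<=` M := @connected_component_sub _ M y.
exists C; split.
- exact: component_continuum.
- apply: contrapT => nC.
  have CV : C `<=` V.
    move=> x Cx; have [->//|/eqP xy] := eqVneq x y; exfalso; apply: nC.
    by exists x, y; split => //; exact: connected_component_refl.
  have [N [Ny NM NV clN clN']] := component_clopen_neighbourhood hX cX clM My oV CV.
  have YE : Y `\` N = (M `\` N) `|` (Y `&` ~` V).
    apply/seteqP; split => x.
      move=> [Yx Nx]; have [Vx|Vx] := pselect (V x); last by right.
      by left; split => //; split => //; exact: subset_closure.
    by move=> [[[Yx _] Nx]//|[Yx Vx]]; split => // /NV.
  have clYN : closed (Y `\` N).
    by rewrite YE; apply: closedU => //; apply: closedI => //; exact: open_closedC.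
  have [|||x [_ [Nx [_ /(_ Nx)]]]//] := connected_closed_split cY.2 clN clYN.
  + by move=> x Yx; have [Nx|Nx] := pselect (N x); [left|right].
  + by exists y.
  + exists p; split => //; split => // /NV /subset_closure /clV[_].
    exact.
- exact: connected_component_refl.
- by move=> x /CM[].
- by move=> x /CM[_ /clV[]].
Qed.

(** If K has interior in Y, then the closure Z of the complement of K is not all of
    Y. Either Z is connected, and Y is the union of K and Z, or Z is split by two
    open sets, and adding either part of Z to K gives a proper subcontinuum. *)
Lemma indecomposable_nowhere_dense Y K O : continuum Y -> ~ decomposable Y ->
  continuum K -> K !=set0 -> K `<=` Y -> K <> Y -> open O -> Y `&` O !=set0 ->
  exists2 y, (Y `&` O) y & ~ K y.
Proof.
move=> cY nY cK [k Kk] KY KnY oO [w [Yw Ow]]; apply: contrapT => nO; apply: nY.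
have YOK x : Y x -> O x -> K x.
  by move=> Yx Ox; apply: contrapT => nKx; apply: nO; exists x.
have [u Yu Ku] := proper_subset_ex KY KnY.
have clY := continuum_closed cY; have clK := continuum_closed cK.
pose Z := closure (Y `\` K).
have clZ : closed Z by exact: closed_closure.
have ZY : Z `<=` Y.
  by rewrite [X in _ `<=` X](closure_id _).1 //; apply: closureS => x [].
have sZ x : Y x -> ~ K x -> Z x by move=> Yx Kx; exact: subset_closure.
have wZ : ~ Z w.
  move=> Zw; have [|x [[Yx nKx] Ox]] := Zw O; first exact: open_nbhs_nbhs.
  exact/nKx/YOK.
have [coZ|ncoZ] := pselect (connected Z).
  exists K, Z; split => //.
  - exact: continuumP.
  - apply/seteqP; split => x; last by move=> [/KY|/ZY].
    by move=> Yx; have [Kx|Kx] := pselect (K x); [left|right; exact: sZ].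
  - by move=> ZE; apply: wZ; rewrite ZE.
have [G [H [oG oH GH ZGH [ZG ZH]]]] := disconnected_open_split hX cX clZ ncoZ.
(* A splitting of K together with the G'-part of Z would split Y, because the
   connected set K lies on one side of it. *)
have piece G' H' : open G' -> open H' -> G' `&` H' = set0 ->
    Z `<=` G' `|` H' -> Z `&` G' !=set0 -> Z `&` H' !=set0 ->
    continuum (K `|` (Z `&` G')) /\ K `|` (Z `&` G') <> Y.
  move=> oG' oH' GH' ZGH' ZG' [h [Zh Hh]].
  have disj x : G' x -> H' x -> False by move=> Gx Hx; have : set0 x by rewrite -GH'.
  have ZE : Z `&` G' = Z `&` ~` H'.
    apply/seteqP; split => x [Zx Gx]; split => //; first by move=> /(disj _ Gx).
    by have [] := ZGH' x Zx.
  have ZE' : Z `&` H' = Z `&` ~` G'.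
    apply/seteqP; split => x [Zx Gx]; split => //; first by move=> /disj /(_ Gx).
    by have [] := ZGH' x Zx.
  have clZG : closed (Z `&` G').
    by rewrite ZE; apply: closedI => //; exact: open_closedC.
  have clZH : closed (Z `&` H').
    by rewrite ZE'; apply: closedI => //; exact: open_closedC.
  have clP : closed (K `|` (Z `&` G')) by exact: closedU.
  split; last first.
    move=> PY; have [|x [[Yx Kx] Hx]] := Zh H'; first exact: open_nbhs_nbhs.
    by have := Yx; rewrite -PY => -[//|[_ /disj /(_ Hx)]].
  apply: continuumP => //; apply: contrapT => ncoP.
  have [S [T [oS oT ST PST [PS PT]]]] := disconnected_open_split hX cX clP ncoP.
  wlog Sk : S T oS oT ST PST PS PT / S k.
    move=> wl; have [|Sk|Tk] := PST k; first by left.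
      exact: (wl S T).
    by apply: (wl T S) => //; [rewrite setIC|rewrite (setUC T)].
  have disjS x : S x -> T x -> False by move=> Sx Tx; have : set0 x by rewrite -ST.
  have KT x : K x -> ~ T x.
    move=> Kx Tx; have [|||y [_ [Sy Ty]]] := connected_open_split cK.2 oS oT.
    - by move=> y Ky; apply: PST; left.
    - by exists k.
    - by exists x.
    exact: (disjS y).
  pose P := K `|` (Z `&` G').
  have clPT : closed (P `&` ~` S).
    by apply: closedI => //; exact: open_closedC.
  have clPS : closed (P `&` ~` T).
    by apply: closedI => //; exact: open_closedC.
  have PTS x : P x -> ~ S x -> T x by move=> Px nSx; have [] := PST x Px.
  have [|||y [_ [[Py Sy] [[_ Ty]|[Zy Hy]]]]] := connected_closed_split cY.2 clPT
     (closedU clPS clZH).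
  - move=> y Yy; have [Py|nPy] := pselect (P y).
      have [Sy|Sy] := pselect (S y); last by left.
      by right; left; split => // /(disjS _ Sy).
    have Zy : Z y by apply: sZ => // Ky; apply: nPy; left.
    right; right; split => //; have [Gy|//] := ZGH' y Zy.
    by exfalso; apply: nPy; right.
  - have [t [Pt Tt]] := PT; exists t; split; first by case: Pt => [/KY|[/ZY]].
    by split => // /disjS /(_ Tt).
  - exists k; split; first exact: KY.
    by left; split; [left|exact: KT].
  - exact/Ty/PTS.
  - case: Py => [Ky|[_ /disj /(_ Hy)//]].
    exact: (KT y Ky (PTS y (or_introl Ky) Sy)).
have [cP PY] := piece G H oG oH GH ZGH ZG ZH.
have [||cQ QY] := piece H G oH oG _ _ ZH ZG; rewrite ?(setIC H) ?(setUC H)//.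
exists (K `|` (Z `&` G)), (K `|` (Z `&` H)); split => //.
apply/seteqP; split => x.
  move=> Yx; have [Kx|Kx] := pselect (K x); first by left; left.
  by have Zx := sZ _ Yx Kx; have [] := ZGH x Zx; [left|right]; right.
by move=> [] [/KY|[/ZY]].
Qed.

End decomposability.


(** * Suslinean continua are hereditarily decomposable *)

Section suslinean_decomposability.
Context {R : realType} {X : metricType R}.
Hypothesis cX : compact [set: X].
Implicit Types (A K P Q Y O : set X).

Lemma countable_enumeration (T : Type) (t : T) (A : set T) : countable A ->
  exists f : nat -> T, A `<=` range f.
Proof.
rewrite /countable => /pfcard_geP[->|[f]]; first by exists (fun=> t).
by exists f; rewrite image_eq.
Qed.

Lemma compact_countable_base (x0 : X) : exists V : nat -> set X,
  (forall n, open (V n)) /\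
  forall x O, open O -> O x -> exists n, V n x /\ V n `<=` O.
Proof.
(* compact_second_countable is about spaces with a base point, here x0. *)
pose pX : pseudoPMetricType R := HB.pack X (isPointed.Build X x0).
have [B cB [oB nB]] := @compact_second_countable R pX cX.
have [f fB] := countable_enumeration set0 cB.
exists (fun n => if pselect (B (f n)) is left _ then f n else set0); split.
  by move=> n; case: pselect => [/oB//|_]; exact: open0.
move=> x O oO Ox; have [|U [BU Ux] UO] := nB x O; first exact: open_nbhs_nbhs.
by have [n _ fn] := fB _ BU; exists n; rewrite fn; case: pselect.
Qed.

(** Suppose that Y is indecomposable. In the proof kappa K is the union of the
    proper subcontinua that include K. Take a maximal family of proper nondegenerate
    subcontinua with disjoint kappas: it is countable, and each kappa is covered by
    countably many proper subcontinua, the components in Y of the complements of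
    basic open sets, which are nowhere dense. A point of Y outside all of them lies
    in some proper nondegenerate subcontinuum, whose kappa misses all the others
    because the union of two meeting proper subcontinua is proper. *)
Lemma suslinean_decomposable Y : suslinean X -> continuum Y ->
  nondegenerate_set Y -> decomposable Y.
Proof.
move=> sX cY ndY; apply: contrapT => nY.
have [x0 [x1 [Yx0 _ _]]] := ndY.
have clY := continuum_closed cY.
pose proper K := [/\ continuum K, K `<=` Y & K <> Y].
pose D := [set K | proper K /\ nondegenerate_set K].
pose kappa K := [set y | exists L, [/\ proper L, K `<=` L & L y]].
have [E [ED tE maxE]] := ex_maximal_disjoint_subcollection kappa D.
have kappa_sub K : D K -> K `<=` kappa K.
  by move=> [pK _] x Kx; exists K; split.
have cE : countable E.
  apply: sX; first by move=> A /ED[[? _ _] ?].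
  move=> K K' EK EK' [x [Kx K'x]]; apply: tE => //; exists x.
  by split; apply: kappa_sub => //; exact: ED.
have properU L L' : proper L -> proper L' -> L `&` L' !=set0 -> proper (L `|` L').
  move=> [cL LY LnY] [cL' L'Y L'nY] LL'; split; first exact: continuumU.
    by move=> x [/LY|/L'Y].
  by move=> LUY; apply: nY; exists L, L'.
have [f Ef] := countable_enumeration set0 cE.
have [V [oV Vb]] := compact_countable_base x0.
have [c cP] : exists c : set X -> X, forall K, D K -> K (c K).
  have cex K : exists x, D K -> K x.
    by have [[_ [x [x' [Kx _ _]]]]|nK] := pselect (D K); [exists x|exists x0].
  by have [c cP] := choice cex; exists c.
(* The case distinction keeps the covering subcontinua proper: when V m misses
   Y, the component in question may be the whole of Y. *)
pose F k := let: (n, m) := odflt (0%N, 0%N) (unpickle k) in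
  if pselect (Y `&` V m !=set0) is left _ then
    connected_component (Y `&` ~` V m) (c (f n)) else set0.
have clYV m : closed (Y `&` ~` V m) by apply: closedI => //; exact: open_closedC.
have [|||y Yy nF] := avoid_countable_nowhere_dense
    (metric_hausdorff (T:=X)) cX (F := F) clY.
- by exists x0.
- move=> k; rewrite /F; case: (odflt _ _) => n m; case: pselect => _; last exact: closed0.
  exact: component_closed.
- move=> k Q oQ YQ; have [->|/set0P F0] := eqVneq (F k) set0.
    by have [y YQy] := YQ; exists y.
  move: F0; rewrite /F; case: (odflt _ _) => n m; case: pselect => [YV|_ []//] F0.
  have sub := @connected_component_sub _ (Y `&` ~` V m) (c (f n)).
  apply: indecomposable_nowhere_dense => //; first exact: component_continuum.
    by move=> x /sub[].
  move=> CY; have [y [Yy Vy]] := YV.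
  by have [] : (Y `&` ~` V m) y by apply: sub; rewrite CY.
have [p Yp py] := nondegenerate_neq y ndY.
have [|K [cK ndK Ky KY Kp]] :=
  boundary_bumping cX cY ndY (closed_openC (@metric_closed_set1 _ _ p)) Yy.
  by move=> yp; apply: py.
have DK : D K by split => //; split => // KE; apply: (Kp p) => //; rewrite KE.
have [K' EK' [L [pL K'L Ly]]] : exists2 K', E K' & kappa K' y.
  apply: contrapT => nE; apply: (maxE (E `|` [set K])).
  - split; first by move=> ?; left.
    move=> EK; apply: nE; exists K; last exact: kappa_sub.
    by apply: EK; right.
  - by move=> K0 [/ED|->].
  have main K1 : E K1 -> kappa K1 `&` kappa K !=set0 -> False.
    move=> EK1 [w [[L1 [pL1 K1L1 L1w]] [L2 [pL2 KL2 L2w]]]]; apply: nE; exists K1 => //.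
    exists (L1 `|` L2); split; first by apply: properU => //; exists w.
      by move=> z /K1L1; left.
    by right; exact: KL2.
  move=> K1 K2 [EK1|->] [EK2|->] //.
  - exact: tE.
  - by move=> /(main _ EK1).
  - by rewrite setIC => /(main _ EK2).
have [n _ fn] := Ef _ EK'.
have [cL LY LnY] := pL; have [z Yz Lz] := proper_subset_ex LY LnY.
have [m [Vz VL]] := Vb z _ (closed_openC (continuum_closed cL)) Lz.
apply: (nF (pickle (n, m))); rewrite /F pickleK /=; case: pselect; last first.
  by move=> nYV; exfalso; apply: nYV; exists z.
move=> _; exists L => //; rewrite fn; split; last exact: cL.2.
  by apply: K'L; apply: cP; exact: ED.
by move=> w Lw; split; [exact: LY|move=> /VL].
Qed.

End suslinean_decomposability.


(** * Linear orders and convexity *)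

Record linear_order (T : Type) (le : T -> T -> Prop) : Prop := LinearOrder {
  lo_refl : forall x, le x x;
  lo_trans : forall y x z, le x y -> le y z -> le x z;
  lo_anti : forall x y, le x y -> le y x -> x = y;
  lo_total : forall x y, le x y \/ le y x }.

Definition convex_for (T : Type) (le : T -> T -> Prop) (A : set T) :=
  forall x y z, A x -> A z -> le x y -> le y z -> A y.

Section linear_orders.
Context (T : Type) (le : T -> T -> Prop).
Hypothesis lin : linear_order le.
(* Negation as strict order makes reversing le exchange the two sides, so that
   mirrored statements follow by applying a lemma to the reversed relation. *)
Local Notation "x \le y" := (le x y) (at level 70).
Local Notation "x \lt y" := (~ le y x) (at level 70).

Definition is_lub (S : set T) u :=
  (forall s, S s -> s \le u) /\ forall v, (forall s, S s -> s \le v) -> u \le v.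

Lemma linear_order_rev : linear_order (fun x y => y \le x).
Proof.
case: lin => r t a tot; split => //.
- by move=> y x z yx zy; exact: t zy yx.
- by move=> x y xy yx; exact: a.
Qed.

Lemma lo_ltW x y : x \lt y -> x \le y.
Proof. by move=> xy; have [] := lo_total lin x y. Qed.

Lemma lo_le_lt_trans y x z : x \le y -> y \lt z -> x \lt z.
Proof. by move=> xy yz zx; apply: yz; exact: lo_trans zx xy. Qed.

Lemma lo_lt_le_trans y x z : x \lt y -> y \le z -> x \lt z.
Proof. by move=> xy yz zx; apply: xy; exact: lo_trans yz zx. Qed.

Lemma lo_le_neq_lt x y : x \le y -> x <> y -> x \lt y.
Proof. by move=> xy nxy yx; apply: nxy; exact: lo_anti xy yx. Qed.

Lemma lo_lt_neq x y : x \lt y -> x <> y.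
Proof. by move=> xy xyE; apply: xy; rewrite xyE; exact: lo_refl. Qed.

Lemma lo_neq_lt x y : x <> y -> x \lt y \/ y \lt x.
Proof.
move=> xy; have [le_xy|le_yx] := lo_total lin x y; first by left; exact: lo_le_neq_lt.
by right; apply: lo_le_neq_lt => // yx; exact: xy.
Qed.

Lemma convex_for_rev (A : set T) : convex_for le A -> convex_for (fun x y => y \le x) A.
Proof. by move=> cA x y z Ax Az yx zy; exact: cA zy yx. Qed.

(** Were P to lose a point a and Q a point a', each of the two points would lie in
    the other piece; the smaller of them would then be recovered by convexity. *)
Lemma upward_closed_half (A M P Q : set T) : convex_for le P -> convex_for le Q ->
  M = P `|` Q ->
  (forall c a, M c -> A c -> A a -> c \le a -> M a) ->
  (forall c a, P c -> A c -> A a -> c \le a -> P a) \/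
  (forall c a, Q c -> A c -> A a -> c \le a -> Q a).
Proof.
move=> cP cQ ME MA; apply: contrapT => /not_orP[nP nQ].
have MP c : P c -> M c by rewrite ME; left.
have MQ c : Q c -> M c by rewrite ME; right.
apply: nP => c a Pc Ac Aa ca; apply: contrapT => nPa.
apply: nQ => c' a' Qc' Ac' Aa' ca'; apply: contrapT => nQa'.
have Qa : Q a by have := MA c a (MP _ Pc) Ac Aa ca; rewrite ME => -[].
have Pa' : P a' by have := MA c' a' (MQ _ Qc') Ac' Aa' ca'; rewrite ME => -[].
have [aa'|a'a] := lo_total lin a a'; first by apply: nPa; exact: cP ca aa'.
by apply: nQa'; exact: cQ ca' a'a.
Qed.

End linear_orders.

(** * The order defined by a sequence of chains *)

Section chains.
Context {R : realType} {X : metricType R}.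
Implicit Types (A K : set X) (s : seq (set X)).

Lemma chain_adjacent s i j x : chain s -> (i < size s)%N -> (j < size s)%N ->
  nth set0 s i x -> nth set0 s j x -> (i <= j.+1)%N /\ (j <= i.+1)%N.
Proof.
move=> [_ cs] si sj ix jx.
have : (`|i - j| <= 1)%N by apply/(cs i j si sj); exists x.
lia.
Qed.

Lemma chain_meet s i : chain s -> (i.+1 < size s)%N ->
  nth set0 s i `&` nth set0 s i.+1 !=set0.
Proof. by move=> [_ cs] si; apply/cs; lia. Qed.

Lemma mdist_link s i x y e : (mesh s < e%:E)%E -> (i < size s)%N ->
  nth set0 s i x -> nth set0 s i y -> mdist x y < e.
Proof.
move=> mse si ix iy; rewrite -lte_fin; apply: le_lt_trans mse.
have : (diameter (nth set0 s i) <= mesh s)%E.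
  apply: (@le_bigmax_seq _ _ _ s -oo%E (nth set0 s i) xpredT diameter) => //.
  exact: mem_nth.
by apply: le_trans; apply: ereal_sup_ubound; exists (x, y).
Qed.

Lemma mdist_links s i k x y e : chain s -> (mesh s < e%:E)%E ->
  (i + k < size s)%N -> nth set0 s i x -> nth set0 s (i + k) y ->
  mdist x y < e *+ k.+1.
Proof.
move=> cs mse; elim: k y => [|k IH] y si ix.
  by rewrite addn0; apply: (mdist_link mse) ix; lia.
move=> iy; have [|p [ip ip']] := @chain_meet s (i + k) cs; first by lia.
rewrite mulrSr; apply: le_lt_trans (metric_triangle x p y) _.
apply: ltrD; first by apply: IH => //; lia.
by apply: (mdist_link mse si) => //; rewrite addnS.
Qed.

(** Otherwise the links before the j-th and the links after it would split A:
    links at distance two or more are disjoint. *)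
Lemma chain_between s A i j l : chain s -> covers s -> connected A ->
  (i <= j)%N -> (j <= l)%N -> (l < size s)%N ->
  A `&` nth set0 s i !=set0 -> A `&` nth set0 s l !=set0 ->
  A `&` nth set0 s j !=set0.
Proof.
move=> cs cov cA ij jl sl [x [Ax ix]] [y [Ay ly]]; apply: contrapT => nj.
have nAj z : A z -> ~ nth set0 s j z by move=> Az jz; apply: nj; exists z.
have os := cs.1.
have [|||||z [_ [[m /= mj mz] [m' /= /andP[jm' m's] mz']]]] :=
  @connected_open_split _ A (\bigcup_(m in [set m | (m < j)%N]) nth set0 s m)
   (\bigcup_(m in [set m | (j < m < size s)%N]) nth set0 s m) cA.
- by apply: bigcup_open => m /= mj; apply: os; lia.
- by apply: bigcup_open => m /= /andP[_]; exact: os.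
- move=> z Az; have [m ms mz] := cov z.
  have [mj|jm|mj] := ltngtP m j; [by left; exists m|right|].
    by exists m => //=; apply/andP.
  by exfalso; apply: (nAj z) => //; rewrite -mj.
- exists x; split => //; exists i => //=; rewrite ltn_neqAle ij andbT.
  by apply/eqP => ij'; apply: (nAj x) => //; rewrite -ij'.
- exists y; split => //; exists l => //=; rewrite sl andbT ltn_neqAle jl andbT.
  by apply/eqP => jl'; apply: (nAj y) => //; rewrite jl'.
have [|_] := chain_adjacent cs _ m's mz mz'; lia.
Qed.

Context (D : nat -> seq (set X)) (U : set_system nat).
Hypotheses (cX : compact [set: X]) (D_chain : forall n, chain (D n))
  (D_covers : forall n, covers (D n))
  (D_mesh : mesh (D n) @[n --> \oo] --> 0%:E)
  (U_ultra : UltraFilter U) (U_np : nonprincipal U).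

Lemma mesh_small e : 0 < e -> \forall n \near \oo, (mesh (D n) < e%:E)%E.
Proof.
move=> e0; have nb : nbhs (0%:E : \bar R) [set y | (y < e%:E)%E].
  exact: (@nbhs_open_ereal_lt _ 0 (fun=> e)).
exact: (D_mesh nb).
Qed.

Lemma ultra_near (P : set nat) : (\forall n \near \oo, P n) -> U P.
Proof.
have UP : ProperFilter U := ultra_proper.
move=> [N _ NP]; apply: filterS NP _.
elim: N => [|N IH]; first by apply: filterS filterT => n _.
have [UN|UN] := in_ultra_setVsetC [set N] U_ultra.
  exfalso; apply: (U_np (t := N)).
  apply/esym/max_filter; first exact: principal_filter_proper.
  move=> A UA; apply/principal_filterP.
  by have [n [/= -> An]] := filter_ex (filterI UN UA).
apply: filterS (filterI IH UN) => n [/= Nn nN].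
rewrite ltn_neqAle Nn andbT; apply/eqP => NE; exact: nN.
Qed.

Lemma ultra_pick (P Q : set nat) : U P -> (\forall n \near \oo, Q n) ->
  exists n, P n /\ Q n.
Proof.
have UP : ProperFilter U := ultra_proper.
by move=> UPP /ultra_near UQ; have [n Pn] := filter_ex (filterI UPP UQ); exists n.
Qed.

(** Only points at small distance can be compared inconsistently by a chain: links
    that are at most two apart are at small distance, and the mesh tends to 0. *)
Lemma ultrafilter_le_linear : linear_order (ultrafilter_le D U).
Proof.
have UP : ProperFilter U := ultra_proper.
split.
- move=> x; apply: filterS filterT => n _; have [i si ix] := D_covers n x.
  by exists i, i; split => //; rewrite leqnn.
- move=> y x z xy yz; have [->//|xNy] := eqVneq x y.
  have xy0 : 0 < mdist x y by rewrite mdist_gt0.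
  apply: filterS (filterI (filterI xy yz) (ultra_near (mesh_small xy0))).
  move=> n [[[i [j [/andP[ij sj] ix jy]]] [k [l [/andP[kl sl] ky lz]]]] msh].
  have [il|li] := leqP i l; first by exists i, l; rewrite il sl.
  exfalso; have [||] := chain_adjacent (D_chain n) _ _ jy ky; try lia.
  move=> jk kj; have jE : j = i by lia.
  move: jy sj; rewrite jE => jy si.
  by have := mdist_link msh si ix jy; rewrite ltxx.
- move=> x y xy yx; apply: contrapT => /eqP xNy.
  have xy0 : 0 < mdist x y / 3 by rewrite divr_gt0// mdist_gt0.
  have [n [[[i [j [/andP[ij sj] ix jy]]] [k [l [/andP[kl sl] ky lx]]]] msh]] :=
    ultra_pick (filterI xy yx) (mesh_small xy0).
  have [||] := chain_adjacent (D_chain n) _ _ jy ky; try lia.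
  have [||] := chain_adjacent (D_chain n) _ _ ix lx; try lia.
  move=> il li jk kj; have jE : j = (i + (j - i))%N by lia.
  move: jy; rewrite jE => jy; have si : (i + (j - i) < size (D n))%N by lia.
  have := mdist_links (D_chain n) msh si ix jy.
  have ji : ((j - i).+1 <= 3)%N by lia.
  apply/negP; rewrite -leNgt -[leLHS]mulr_natr.
  have le3 : mdist x y / 3 * (j - i).+1%:R <= mdist x y / 3 * 3.
    by rewrite ler_pM2l// ler_nat.
  by apply: le_trans le3 _; rewrite divfK.
- move=> x y; have [|xy] := in_ultra_setVsetC [set n | chain_le (D n) x y] U_ultra.
    by left.
  right; apply: filterS xy => n xy.
  have [i si ix] := D_covers n x; have [j sj jy] := D_covers n y.
  have [ij|/ltnW ji] := leqP i j; last by exists j, i; rewrite ji si.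
  by exfalso; apply: xy; exists i, j; rewrite ij sj.
Qed.

(** Lebesgue's covering lemma, with the links of the chains in place of sets of
    small diameter. *)
Lemma links_subordinate (C : set (set X)) :
  (forall x, exists W, [/\ C W, open W & W x]) ->
  \forall n \near \oo, forall i, (i < size (D n))%N ->
    exists2 W, C W & nth set0 (D n) i `<=` W.
Proof.
move=> Ccov.
have /compact_near_coveringP := cX.
move=> /(_ nat \oo (fun n x => forall i, (i < size (D n))%N ->
   nth set0 (D n) i x -> exists2 W, C W & nth set0 (D n) i `<=` W)).
case=> [|N _ NP].
  move=> x _; have [W [CW oW Ox]] := Ccov x.
  have /nbhs_ballP[e /= e0 eW] : nbhs x W by exact: open_nbhs_nbhs.
  have e2 : 0 < e / 2 by rewrite divr_gt0.
  exists (ball x (e / 2), [set n | (mesh (D n) < (e / 2)%:E)%E]) => /=.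
    by split; [exact: nbhsx_ballx|exact: mesh_small].
  move=> [x' n] [/= bx' msh] i si ix'; exists W => // y iy; apply: eW.
  rewrite [e]splitr; apply: ball_triangle bx' _; rewrite ballEmdist /=.
  exact: (mdist_link msh si).
exists N => // n Nn i si.
have [|x [ix _]] := ((D_chain n).2 i i si si).2; first by lia.
exact: (NP n Nn x I i si ix).
Qed.

(** If y were not in A, then for large n no link would both contain y and meet A,
    against chain_between. *)
Lemma continuum_convex A : continuum A -> convex_for (ultrafilter_le D U) A.
Proof.
move=> cA x y z Ax Az xy yz; apply: contrapT => nAy.
have UP : ProperFilter U := ultra_proper.
have clA : closed A by exact: continuum_closed.
have cly := @metric_closed_set1 _ _ y.
have [|n [[]]] := ultra_pick (filterI xy yz)
  (links_subordinate (C := [set W | W `<=` ~` A \/ W `<=` ~` [set y]]) _).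
  move=> p; have [->|/eqP py] := eqVneq p y.
    by exists (~` A); split => //; [left|exact: closed_openC].
  by exists (~` [set y]); split => //; [right|exact: closed_openC].
move=> [i [j [/andP[ij sj] ix jy]]] [k [l [/andP[kl sl] ky lz]]] sub.
have avoid m : (m < size (D n))%N -> nth set0 (D n) m y ->
    ~ (A `&` nth set0 (D n) m !=set0).
  move=> sm my [p [Ap mp]]; have [W [OA|Oy] mW] := sub m sm.
    exact: (OA p (mW p mp)).
  exact: (Oy y (mW y my)).
have [||jk kj] := chain_adjacent (D_chain n) _ _ jy ky; try lia.
have [jl|lj] := leqP j l.
  apply: (avoid j) => //; apply: (chain_between (D_chain n) (D_covers n) cA.2 ij jl) => //.
    by exists x.
  by exists z.
apply: (avoid k) => //; first by lia.
by exists z; split => //; have -> : k = l by lia.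
Qed.

(** Let G and H split the intersection. When the links are small, those meeting
    both K and K' are inside G or inside H. All the links of a chain between a point
    of the G-part and a point of the H-part are of this kind, and consecutive links
    meet, so that the chain cannot pass from G to H. *)
Lemma chain_hereditarily_unicoherent K K' :
  continuum K -> continuum K' -> connected (K `&` K').
Proof.
move=> cK cK'; apply: contrapT => ncM.
have clK : closed K by exact: continuum_closed.
have clK' : closed K' by exact: continuum_closed.
have [G [H [oG oH GH MGH [[x [[Kx K'x] Gx]] [y [[Ky K'y] Hy]]]]]] :=
  disconnected_open_split (metric_hausdorff (T:=X)) cX (closedI clK clK') ncM.
have [|n sub] := filter_ex (links_subordinate
   (C := [set W | [\/ W `<=` ~` K, W `<=` ~` K', W `<=` G | W `<=` H]]) _).
  move=> p; have [Kp|Kp] := pselect (K p); last first.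
    by exists (~` K); split => //; [constructor 1|exact: closed_openC].
  have [K'p|K'p] := pselect (K' p); last first.
    by exists (~` K'); split => //; [constructor 2|exact: closed_openC].
  have [Gp|Hp] := MGH p (conj Kp K'p).
    by exists G; split => //; constructor 3.
  by exists H; split => //; constructor 4.
have [i si ix] := D_covers n x; have [j sj jy] := D_covers n y.
wlog ij : G H oG oH GH MGH x Kx K'x Gx y Ky K'y Hy sub i si ix j sj jy / (i <= j)%N.
  move=> wl; have [ij|/ltnW ji] := leqP i j.
    exact: (wl G H oG oH GH MGH x Kx K'x Gx y Ky K'y Hy sub i si ix j sj jy ij).
  apply: (wl H G oH oG _ _ y Ky K'y Hy x Kx K'x Gx _ j sj jy i si ix ji).
  - by rewrite setIC.
  - by rewrite setUC.
  - by move=> m /sub[W [] ? ?]; exists W => //;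
    [constructor 1|constructor 2|constructor 4|constructor 3].
have disj p : G p -> H p -> False by move=> Gp Hp; have : set0 p by rewrite -GH.
have sub' m : (m < size (D n))%N -> K `&` nth set0 (D n) m !=set0 ->
    K' `&` nth set0 (D n) m !=set0 ->
    nth set0 (D n) m `<=` G \/ nth set0 (D n) m `<=` H.
  move=> sm [p [Kp mp]] [p' [K'p mp']]; have [W [] OO mW] := sub m sm.
  - by exfalso; apply: (OO p (mW p mp)).
  - by exfalso; apply: (OO p' (mW p' mp')).
  - by left; exact: subset_trans OO.
  - by right; exact: subset_trans OO.
have allG k : (i + k <= j)%N -> nth set0 (D n) (i + k) `<=` G.
  elim: k => [|k IH] ikj.
    rewrite addn0; have [||//|iH] := sub' i si; [by exists x|by exists x|].
    by exfalso; apply: (disj x) => //; exact: iH.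
  have sik : (i + k.+1 < size (D n))%N by lia.
  have [||//|iH] := sub' (i + k.+1)%N sik.
  - apply: (chain_between (i := i) (l := j)); rewrite ?leq_addr //; first exact: cK.2.
      by exists x.
    by exists y.
  - apply: (chain_between (i := i) (l := j)); rewrite ?leq_addr //; first exact: cK'.2.
      by exists x.
    by exists y.
  - exfalso; have [|p [kp k1p]] := @chain_meet (D n) (i + k) (D_chain n); first lia.
    apply: (disj p); first by apply: IH kp; lia.
    by apply: iH; rewrite addnS.
apply: (disj y) => //; apply: (allG (j - i)%N); last by rewrite subnKC.
by rewrite subnKC.
Qed.

End chains.


(** * Operations on F_sigma sets *)

Section Fsigma_operations.
Context {T : topologicalType}.
Implicit Types (A B : set T).

Lemma Fsigma_bigcup (I : countType) (D : set I) (F : I -> set T) :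
  (forall i, D i -> Fsigma (F i)) -> Fsigma (\bigcup_(i in D) F i).
Proof.
move=> FF; have FF' i : exists G : nat -> set T,
    D i -> (forall n, closed (G n)) /\ F i = \bigcup_n G n.
  have [Di|Di] := pselect (D i); last by exists (fun=> set0).
  by have [G] := FF i Di; exists G.
have [G GP] := choice FF'.
pose H (p : I * nat) := if pselect (D p.1) is left _ then G p.1 p.2 else set0.
exists (fun k => if unpickle k is Some p then H p else set0).
  move=> k; case: unpickle => [p|]; last exact: closed0.
  by rewrite /H; case: pselect => [/GP[]|_] //; exact: closed0.
apply/seteqP; split => [x [i Di]|x [k _]].
  rewrite (GP i Di).2 => -[m _ Gx]; exists (pickle (i, m)) => //.
  by rewrite pickleK /H /=; case: pselect.
case: unpickle => [[i m]|//]; rewrite /H /=; case: pselect => // Di Gx.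
by exists i => //; rewrite (GP i Di).2; exists m.
Qed.

Lemma Fsigma_setI A B : Fsigma A -> Fsigma B -> Fsigma (A `&` B).
Proof.
move=> [F clF ->] [G clG ->]; rewrite setI_bigcupl; apply: Fsigma_bigcup => n _.
by rewrite setI_bigcupr; exists (fun m => F n `&` G m) => // m; exact: closedI.
Qed.

End Fsigma_operations.


(** * Hulls, splittings and completeness of the order *)

Section hulls.
Context {R : realType} {X : metricType R}.
Implicit Types (A B K P Q M Y W : set X).
Hypotheses (cX : continuum [set: X])
  (unicoherent : forall K K', continuum K -> continuum K' -> connected (K `&` K'))
  (deco : forall Y, continuum Y -> nondegenerate_set Y -> decomposable Y).

Let hX : hausdorff_space X := metric_hausdorff (T:=X).

Definition hull (x y : X) :=
  \bigcap_(A in [set A | [/\ continuum A, A x & A y]]) A.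

Lemma hull_sub x y A : continuum A -> A x -> A y -> hull x y `<=` A.
Proof. by move=> cA Ax Ay z; apply. Qed.

Lemma hull_l x y : hull x y x. Proof. by move=> A []. Qed.

Lemma hull_r x y : hull x y y. Proof. by move=> A []. Qed.

Lemma hull_continuum x y : continuum (hull x y).
Proof.
have clF A : [/\ continuum A, A x & A y] -> closed A.
  by move=> [cA _ _]; exact: continuum_closed.
apply: (continuumP cX.1); first exact: closed_bigI.
apply: (directed_bigcap_connected hX cX.1); first by exists setT.
- move=> A B [cA Ax Ay] [cB Bx By]; exists (A `&` B) => //; split => //.
  apply: (continuumP cX.1); first by apply: closedI; apply: clF.
  exact: unicoherent.
- exact: clF.
- by move=> A [[]].
Qed.

(** The pieces P and Q of a decomposition of the hull are proper, so by minimality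
    of the hull neither contains both points. *)
Lemma hull_split x y : x <> y -> exists P Q z,
  [/\ continuum P /\ continuum Q, hull x y = P `|` Q, P x /\ ~ P y,
      Q y /\ ~ Q x & P z /\ Q z].
Proof.
move=> xy; have [|P [Q [cP cQ HE PH QH]]] := deco (hull_continuum x y).
  by exists x, y; split => //; [exact: hull_l|exact: hull_r].
have PQ S : S `<=` hull x y -> continuum S -> S x -> S y -> S = hull x y.
  by move=> SH cS Sx Sy; apply/seteqP; split => //; exact: hull_sub.
have subP : P `<=` hull x y by rewrite HE; left.
have subQ : Q `<=` hull x y by rewrite HE; right.
have nP : P x -> ~ P y by move=> Px Py; apply: PH; exact: PQ.
have nQ : Q x -> ~ Q y by move=> Qx Qy; apply: QH; exact: PQ.
have Hx := hull_l (x := x) (y := y); have Hy := hull_r (x := x) (y := y).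
have [z [_ [Pz Qz]]] : hull x y `&` (P `&` Q) !=set0.
  apply: connected_closed_split; first exact: (hull_continuum x y).2.
  - exact: continuum_closed.
  - exact: continuum_closed.
  - by rewrite HE.
  - apply: contrapT => nHP; apply: QH; rewrite HE; apply/seteqP; split => p.
      by right.
    by move=> [Pp|//]; exfalso; apply: nHP; exists p; split => //; exact: subP.
  - apply: contrapT => nHP; apply: PH; rewrite HE; apply/seteqP; split => p.
      by left.
    by move=> [//|Qp]; exfalso; apply: nHP; exists p; split => //; exact: subQ.
rewrite HE in Hx Hy.
case: Hx => [Px|Qx].
  have Qy : Q y by case: Hy => // Py; case: (nP Px).
  have nPy := nP Px; have nQx : ~ Q x by move=> Qx; exact: (nQ Qx).
  by exists P, Q, z.
have Py : P y by case: Hy => // Qy; case: (nQ Qx).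
have nQy := nQ Qx; have nPx : ~ P x by move=> Px; exact: (nP Px).
by exists Q, P, z; split => //; rewrite HE setUC.
Qed.

Section one_order.
Context (le : X -> X -> Prop).
Hypotheses (lin : linear_order le)
  (cvx : forall A, continuum A -> convex_for le A).
Local Notation "x \le y" := (le x y) (at level 70).
Local Notation "x \lt y" := (~ le y x) (at level 70).

Lemma hull_interval x y z : x \le z -> z \le y -> hull x y z.
Proof.
move=> xz zy; apply: (cvx (hull_continuum x y)) xz zy; first exact: hull_l.
exact: hull_r.
Qed.

(** The piece P of hull x y stays below y, and the piece of a splitting of hull x z
    that contains z, where z is between x and y, moreover stays above x. *)
Lemma interval_continuum x y : x \lt y -> exists K,
  [/\ continuum K, nondegenerate_set K & forall k, K k -> x \lt k /\ k \lt y].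
Proof.
move=> xy; have xNy := lo_lt_neq lin xy.
have [P [Q [z [[cP cQ] HE [Px nPy] [Qy nQx] [Pz Qz]]]]] := hull_split xNy.
have xNz : x <> z by move=> xz; apply: nQx; rewrite xz.
have Pbelow p : P p -> p \lt y.
  move=> Pp yp; apply: nPy; exact: (cvx cP) Px Pp (lo_ltW lin xy) yp.
have zy := Pbelow z Pz.
have xz : x \lt z.
  by move=> zx; apply: nQx; exact: (cvx cQ) Qz Qy zx (lo_ltW lin xy).
have [P1 [P2 [w [[cP1 cP2] HE' [P1x nP1z] [P2z nP2x] [P1w P2w]]]]] := hull_split xNz.
exists P2; split => //; first by exists z, w; split => // zw; apply: nP1z; rewrite zw.
move=> k P2k.
have kP : P k by apply: (hull_sub cP Px Pz); rewrite HE'; right.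
split; last exact: Pbelow.
by move=> kx; apply: nP2x; exact: (cvx cP2) P2k P2z kx (lo_ltW lin xz).
Qed.

(** The limit of hull y w as y increases to w has no point c below w: splitting
    hull c w yields a point z between c and w such that hull z w misses c. *)
Lemma hull_left_limit w c : (forall y, y \lt w -> hull y w c) -> w \le c.
Proof.
move=> hc; apply: contrapT => cw.
have [P [Q [z [[cP cQ] HE [Pc nPw] [Qw nQc] [Pz Qz]]]]] := hull_split (lo_lt_neq lin cw).
have zw : z \lt w.
  by move=> wz; apply: nPw; exact: (cvx cP) Pc Pz (lo_ltW lin cw) wz.
by apply: nQc; exact: (hull_sub cQ Qz Qw) (hc z zw).
Qed.

Lemma hull_left_cluster W w y0 : open W -> W w -> y0 \lt w ->
  (forall y, y \lt w -> ~ (hull y w `<=` W)) ->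
  exists2 c, w \lt c & forall y, y \lt w -> hull y w c.
Proof.
move=> oW Ww y0w nW.
pose F := [set hull y w | y in [set y | y \lt w]].
have [capW|/existsNP[c /not_implyP[Fc nWc]]] := pselect (\bigcap_(A in F) A `<=` W).
  have [|||A [y yw <-] yW] := directed_bigcap_open cX.1 _ _ _ oW capW.
  - by exists (hull y0 w), y0.
  - have mono a b : a \le b -> b \lt w -> hull b w `<=` hull a w.
      move=> ab bw; apply: hull_sub; [exact: hull_continuum| |exact: hull_r].
      exact: hull_interval ab (lo_ltW lin bw).
    move=> _ _ [a aw <-] [b bw <-]; have [ab|ba] := lo_total lin a b.
      by exists (hull b w); [exists b|move=> z Hz; split => //; exact: mono Hz].
    by exists (hull a w); [exists a|move=> z Hz; split => //; exact: mono Hz].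
  - by move=> _ [a _ <-]; apply: continuum_closed; exact: hull_continuum.
  by exfalso; exact: (nW y).
have hc y : y \lt w -> hull y w c by move=> yw; apply: Fc; exists y.
exists c => //; apply: (lo_le_neq_lt lin); first exact: hull_left_limit.
by move=> wc; apply: nWc; rewrite -wc.
Qed.

(** Call a continuum good if it contains, with any of its points of A, all larger
    points of A, and with any of its points of B, all smaller points of B. Good
    continua are nondegenerate, as A has no maximum and B no minimum, and a minimal
    one exists by compactness. If it is the union of proper subcontinua P and Q,
    one of them is good towards A and one towards B; they are different pieces by
    minimality, and then convexity lets the gap be crossed inside one of them. *)
Lemma no_gap A B : (forall x, A x \/ B x) ->
  (forall a b, A a -> B b -> a \lt b) ->
  (forall a, A a -> exists2 a', A a' & a \lt a') ->
  (forall b, B b -> exists2 b', B b' & b' \lt b) -> ~ ([set: X] !=set0).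
Proof.
move=> AB ltAB noA noB [x0 _].
pose upA (F : set X) := forall c a, F c -> A c -> A a -> c \le a -> F a.
pose dnB (F : set X) := forall c b, F c -> B c -> B b -> b \le c -> F b.
pose good F := [/\ continuum F, F !=set0, upA F & dnB F].
have [|S [gS minS]] := @Zorn_bigcup X (fun S => good (~` S)).
  move=> F FP tot; have [F0|/set0P[S0 FS0]] := eqVneq F set0.
    rewrite F0 bigcup_set0 setC0; split => //; by exists x0.
  pose G := [set ~` S | S in F].
  have G0 : G !=set0 by exists (~` S0), S0.
  have GE : ~` (\bigcup_(S in F) S) = \bigcap_(K in G) K.
    apply/seteqP; split => x.
      by move=> nx _ [S FS <-] Sx; apply: nx; exists S.
    by move=> Gx [S FS Sx]; apply: (Gx (~` S)) => //; exists S.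
  have Ggood K : G K -> good K by move=> [S FS <-]; exact: FP.
  have dG : directed G.
    move=> _ _ [S FS <-] [S' FS' <-]; have [SS'|S'S] := tot _ _ FS FS'.
      exists (~` S'); first by exists S'.
      by move=> x S'x; split => // /SS'.
    exists (~` S); first by exists S.
    by move=> x Sx; split => // /S'S.
  have clG K : G K -> closed K by move=> /Ggood[cK _ _ _]; exact: continuum_closed.
  rewrite GE; split.
  - apply: (continuumP cX.1); first exact: closed_bigI.
    by apply: (directed_bigcap_connected hX cX.1) => // K /Ggood[[]].
  - by apply: (directed_bigcap_nonempty cX.1) => // K /Ggood[].
  - move=> c a Gc Ac Aa ca K GK; have [_ _ uK _] := Ggood K GK.
    exact: uK (Gc K GK) Ac Aa ca.
  - move=> c a Gc Ac Aa ca K GK; have [_ _ _ dK] := Ggood K GK.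
    exact: dK (Gc K GK) Ac Aa ca.
set M := ~` S in gS.
have minM N : N `<=` M -> good N -> N = M.
  move=> NM gN; apply: contrapT => NnM; apply: (minS (~` N)); last by rewrite setCK.
  rewrite properEneq; split.
    by apply/eqP => SN; apply: NnM; rewrite /M SN setCK.
  by move=> x Sx Nx; exact: (NM x Nx).
have [cM [m Mm] uM dM] := gS.
have [|P [Q [cP cQ ME PM QM]]] := deco cM.
  have [Am|Bm] := AB m.
    have [a Aa ma] := noA m Am; exists m, a; split => //.
      exact: (uM m a Mm Am Aa (lo_ltW lin ma)).
    exact: (lo_lt_neq lin ma).
  have [b Bb bm] := noB m Bm; exists b, m; split => //.
    exact: (dM m b Mm Bm Bb (lo_ltW lin bm)).
  exact: (lo_lt_neq lin bm).
have MP p : P p -> M p by rewrite ME; left.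
have MQ p : Q p -> M p by rewrite ME; right.
have P0 : P !=set0.
  by apply: contrapT => /nonemptyPn P0; apply: QM; rewrite ME P0 set0U.
have Q0 : Q !=set0.
  by apply: contrapT => /nonemptyPn Q0; apply: PM; rewrite ME Q0 setU0.
have badP : upA P -> ~ dnB P by move=> uP dP; apply/PM/minM.
have badQ : upA Q -> ~ dnB Q by move=> uQ dQ; apply/QM/minM.
have cross P' Q' : continuum Q' -> M = P' `|` Q' -> ~ upA Q' -> ~ dnB P' -> False.
  move=> cQ' ME' nuQ ndP; apply: nuQ => c a Qc Ac Aa ca; apply: contrapT => nQa.
  apply: ndP => c' b Pc' Bc' Bb bc'; apply: contrapT => nPb.
  have Qb : Q' b.
    have : M b by apply: dM Bc' Bb bc'; rewrite ME'; left.
    by rewrite ME' => -[].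
  by apply: nQa; exact: (cvx cQ') Qc Qb ca (lo_ltW lin (ltAB _ _ Aa Bb)).
have cvP := cvx cP; have cvQ := cvx cQ.
have ME' : M = Q `|` P by rewrite setUC.
have [uP|uQ] := upward_closed_half lin cvP cvQ ME uM.
  have ndP := badP uP.
  have [dP|dQ] := upward_closed_half (linear_order_rev lin)
    (convex_for_rev cvP) (convex_for_rev cvQ) ME dM; first exact: ndP.
  by apply: (cross P Q) => // /badQ.
have ndQ := badQ uQ.
have [dP|dQ] := upward_closed_half (linear_order_rev lin)
  (convex_for_rev cvP) (convex_for_rev cvQ) ME dM; last exact: ndQ.
by apply: (cross Q P) => // /badP.
Qed.

Lemma lub_exists S : [set: X] !=set0 -> exists u, is_lub le S u.
Proof.
move=> X0; pose B := [set v | forall s, S s -> s \le v].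
apply: contrapT => nlub; apply: (@no_gap (~` B) B) X0.
- by move=> x; have [Bx|Bx] := pselect (B x); [right|left].
- by move=> a b nBa Bb ba; apply: nBa => s Ss; exact: (lo_trans lin) (Bb s Ss) ba.
- move=> a nBa; apply: contrapT => nmax.
  have maxa a' : ~ B a' -> a' \le a.
    by move=> nBa'; apply: contrapT => aa'; apply: nmax; exists a'.
  apply: nBa => s Ss; apply: contrapT => sa; apply: nlub.
  exists s; split; last by move=> v; apply.
  by apply: contrapT => nBs; apply: sa; exact: maxa.
- move=> b Bb; apply: contrapT => nmin; apply: nlub; exists b; split => // v Bv.
  by apply: contrapT => vb; apply: nmin; exists v.
Qed.

End one_order.
End hulls.


(** * Separability of the order and its relation to the topology *)

Section order_and_topology.
Context {R : realType} {X : metricType R}.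
Implicit Types (A B K P Q M Y W : set X).
Hypotheses (cX : continuum [set: X])
  (unicoherent : forall K K', continuum K -> continuum K' -> connected (K `&` K'))
  (deco : forall Y, continuum Y -> nondegenerate_set Y -> decomposable Y).
Context (le : X -> X -> Prop).
Hypotheses (lin : linear_order le)
  (cvx : forall A, continuum A -> convex_for le A).
Local Notation "x \le y" := (le x y) (at level 70).
Local Notation "x \lt y" := (~ le y x) (at level 70).

Let cvx_rev A : continuum A -> convex_for (fun x y => y \le x) A.
Proof. by move=> /cvx; exact: convex_for_rev. Qed.

(** If both one-sided limits of the hulls at w were to leave W, there would be c
    above w in the limit from the left and d below w in the limit from the right.
    Then d is in hull c w, which lies in the limit from the left, against
    hull_left_limit. *)
Lemma hull_in_open W w : nondegenerate_set [set: X] -> open W -> W w ->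
  exists2 y, y <> w & hull y w `<=` W.
Proof.
move=> ndX oW Ww; apply: contrapT => nW.
have nW' y : y <> w -> ~ (hull y w `<=` W) by move=> yw yW; apply: nW; exists y.
have left_ y0 : y0 \lt w -> exists2 c, w \lt c & forall y, y \lt w -> hull y w c.
  move=> y0w; apply: (hull_left_cluster cX unicoherent deco lin cvx oW Ww y0w).
  by move=> y yw; apply: nW'; exact: lo_lt_neq yw.
have right_ y0 : w \lt y0 -> exists2 c, c \lt w & forall y, w \lt y -> hull y w c.
  move=> y0w; apply: (hull_left_cluster cX unicoherent deco (linear_order_rev lin)
    cvx_rev oW Ww y0w).
  by move=> y yw; apply: nW' => ywE; exact: (lo_lt_neq lin yw).
have both : (exists2 c, w \lt c & forall y, y \lt w -> hull y w c) /\
            (exists2 d, d \lt w & forall y, w \lt y -> hull y w d).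
  have [z _ zw] := nondegenerate_neq w ndX.
  have [zw'|wz] := lo_neq_lt lin zw.
    have [c wc hc] := left_ z zw'; split; first by exists c.
    exact: right_ wc.
  have [d dw hd] := right_ z wz; split; last by exists d.
  exact: left_ dw.
have [[c wc hc] [d dw hd]] := both.
apply: dw; apply: (hull_left_limit cX unicoherent deco lin cvx) => y yw.
apply: hull_sub (hd c wc); [exact: hull_continuum|exact: hc|exact: hull_r].
Qed.

(** For each n, choose a maximal disjoint family of nondegenerate continua of
    diameter less than 1/(n+1); it is countable. Given a continuum K between x and y,
    choose n so large that no member of the n-th family includes K. By maximality
    some member M meets K, and as both are convex, the supremum or the infimum of M
    is in K. *)
Lemma countable_order_dense : suslinean X -> [set: X] !=set0 ->
  exists e : nat -> X, forall x y, x \lt y -> exists n, x \lt e n /\ e n \lt y.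
Proof.
move=> sX X0; have [x0 _] := X0.
have [top topP] := choice (fun S => lub_exists cX deco lin cvx S X0).
have [bot botP] := choice (fun S => lub_exists cX deco
  (linear_order_rev lin) cvx_rev S X0).
pose small n := [set K : set X | [/\ continuum K, nondegenerate_set K &
  forall x y, K x -> K y -> mdist x y < n.+1%:R^-1]].
pose F n := sval (ex_maximal_disjoint_subcollection id (small n)).
have FP n : maximal_disjoint_subcollection id (F n) (small n).
  exact: (svalP (ex_maximal_disjoint_subcollection id (small n))).
have cF n : countable (F n).
  by have [FD tF _] := FP n; apply: sX => // A /FD[].
pose E := \bigcup_n (top @` F n `|` bot @` F n).
have cE : countable E.
  apply: bigcup_countable => // n _.
  have im (f : set X -> X) : countable (f @` F n).
    by apply: sub_countable (cF n); exact: card_image_le.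
  rewrite -bigcup2inE; apply: bigcup_countable => //.
  by move=> [|[|//]] _ /=; exact: im.
have [e Ee] := countable_enumeration x0 cE.
exists e => x y xy.
have [K [cK ndK Kxy]] := interval_continuum cX unicoherent deco lin cvx xy.
suff [p Ep Kp] : exists2 p, E p & K p.
  by have [n _ ne] := Ee _ Ep; exists n; rewrite ne; exact: Kxy.
have [a [b [Ka Kb ab]]] := ndK.
have [n] : exists n : nat, 0 + n.+1%:R^-1 < mdist a b.
  by apply: ltr_add_invr; rewrite mdist_gt0; exact/eqP.
rewrite add0r => nab.
have n2 : 0 < n.+1%:R^-1 / 2 :> R by rewrite divr_gt0.
have [|L [cL ndL La LK Lball]] := boundary_bumping cX.1 cK ndK
  (open_interior (ball a (n.+1%:R^-1 / 2))) Ka.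
  by apply: nbhsx_ballx.
have sL : small n L.
  split => // p q /Lball /interior_subset + /Lball /interior_subset.
  rewrite !ballEmdist /= => ap aq; rewrite [ltRHS]splitr.
  by apply: le_lt_trans (metric_triangle p a q) _; rewrite metric_sym ltrD.
have [FD tF maxF] := FP n.
have [M FM [m [Mm Lm]]] : exists2 M, F n M & M `&` L !=set0.
  apply: contrapT => nM; have [p [q [Lp _ _]]] := ndL.
  apply: (maxF (F n `|` [set L])).
  - split; first by move=> ?; left.
    by move=> FL; apply: nM; exists L; [apply: FL; right|exists p].
  - by move=> K0 [/FD|->].
  move=> K1 K2 [FK1|->] [FK2|->] //=.
  - exact: tF.
  - by move=> K1L; exfalso; apply: nM; exists K1.
  - by rewrite setIC => K2L; exfalso; apply: nM; exists K2.
have [cM _ smallM] := FD _ FM.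
have [k Kk nMk] : exists2 k, K k & ~ M k.
  apply: contrapT => nk; have KM k : K k -> M k.
    by move=> Kk; apply: contrapT => nMk; apply: nk; exists k.
  by have := lt_trans nab (smallM a b (KM a Ka) (KM b Kb)); rewrite ltxx.
have Km : K m by exact: LK.
have [mk|km] := lo_total lin m k.
  exists (top M); first by exists n => //; left; exists M.
  have [ub lub] := topP M; apply: (cvx cK) Km Kk (ub m Mm) (lub k _).
  move=> p Mp; apply: contrapT => pk.
  by apply: nMk; exact: (cvx cM) Mm Mp mk (lo_ltW lin pk).
exists (bot M); first by exists n => //; right; exists M.
have [lb glb] := botP M; apply: (cvx cK) Kk Km (glb k _) (lb m Mm).
move=> p Mp; apply: contrapT => pk.
by apply: nMk; exact: (cvx cM) Mp Mm (lo_ltW lin pk) km.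
Qed.

(** Continua that miss x and contain a point below x stay below x, and by hull_split
    every point below x is in one that also contains a point of the dense sequence.
    Those containing e n are exhausted by the components of e n in the complements
    of a countable base of neighbourhoods of x. *)
Lemma lower_ray_Fsigma (e : nat -> X) x :
  (forall x y, x \lt y -> exists n, x \lt e n /\ e n \lt y) ->
  Fsigma [set z | z \lt x].
Proof.
move=> ed.
pose V m := (ball x m.+1%:R^-1)°.
have Vx m : V m x by exact: nbhsx_ballx.
have clV m : closed (~` V m) by apply: open_closedC; exact: open_interior.
pose C n m := connected_component (~` V m) (e n).
have CV n m : C n m `<=` ~` V m by exact: connected_component_sub.
have -> : [set z | z \lt x] = \bigcup_(n in [set n | e n \lt x]) \bigcup_m C n m.
  apply/seteqP; split => z; last first.
    move=> [n /= enx [m _ Cz]] xz.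
    have Cen : C n m (e n).
      apply: connected_component_refl; apply: contrapT => nV.
      by move: Cz; rewrite /C connected_component_out.
    have cC : continuum (C n m) by apply: component_continuum => //; exact: cX.1.
    by have /CV := cvx cC Cen Cz (lo_ltW lin enx) xz; exact.
  move=> zx; have zNx := lo_lt_neq lin zx.
  have [P [Q [t [[cP cQ] _ [Pz nPx] [Qx nQz] [Pt Qt]]]]] :=
    hull_split cX unicoherent deco zNx.
  have [n Pen] : exists n, P (e n).
    have tz : t <> z by move=> tz; apply: nQz; rewrite -tz.
    have [/ed[n [tn nz]]|/ed[n [zn nt]]] := lo_neq_lt lin tz; exists n.
      exact: (cvx cP) Pt Pz (lo_ltW lin tn) (lo_ltW lin nz).
    exact: (cvx cP) Pz Pt (lo_ltW lin zn) (lo_ltW lin nt).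
  have enx : e n \lt x.
    by move=> xen; apply: nPx; exact: (cvx cP) Pz Pen (lo_ltW lin zx) xen.
  have /nbhs_ballP[r /= r0 rP] : nbhs x (~` P).
    by apply: open_nbhs_nbhs; split => //; apply: closed_openC; exact: continuum_closed.
  have [m] := ltr_add_invr r0; rewrite add0r => mr.
  exists n => //; exists m => //.
  exists P => //; split => //; last exact: cP.2.
  move=> p Pp /interior_subset Vp; apply: (rP p) => //.
  by apply: le_ball Vp; exact: ltW.
apply: Fsigma_bigcup => n _; exists (C n) => // m.
exact: component_closed.
Qed.

End order_and_topology.


(** * The order type of the unit interval *)

Section order_characterization.
Context {R : realType} (T : Type) (le : T -> T -> Prop) (e : nat -> T).
Local Notation "x \le y" := (le x y) (at level 70).
Local Notation "x \lt y" := (~ le y x) (at level 70).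
Hypotheses (lin : linear_order le)
  (lubs : forall S : set T, exists u, is_lub le S u)
  (dense_e : forall x y, x \lt y -> exists n, x \lt e n /\ e n \lt y).

Lemma first_between x y : x \lt y -> exists m, (x \lt e m /\ e m \lt y) /\
  forall k, x \lt e k -> e k \lt y -> (m <= k)%N.
Proof.
move=> /dense_e[n en].
have ex : exists n, `[< x \lt e n /\ e n \lt y >] by exists n; apply/asboolP.
have [m /asboolP em minm] := ex_minnP ex.
by exists m; split => // k xk ky; apply: minm; apply/asboolP.
Qed.

Context (a b : T) (f : T * T -> nat).
Hypotheses (ab : a \lt b) (le_a : forall x, a \le x) (le_b : forall x, x \le b)
  (fP : forall p, p.1 \lt p.2 -> (p.1 \lt e (f p) /\ e (f p) \lt p.2) /\
    forall k, p.1 \lt e k -> e k \lt p.2 -> (f p <= k)%N).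

(** The point of T that will correspond to the dyadic number i / 2^n, for i at most
    2^n. At each stage every interval is cut at the first term of the sequence e
    inside it, so that all terms are eventually reached. *)
Fixpoint dyadic_point n i := if n is m.+1 then
    if odd i then e (f (dyadic_point m i./2, dyadic_point m i./2.+1))
    else dyadic_point m i./2
  else if i is 0 then a else b.
Local Notation p := dyadic_point.

Definition dyadic n i : R := i%:R / 2 ^+ n.

Lemma dyadic_point_double n i : p n.+1 i.*2 = p n i.
Proof. by rewrite /= odd_double doubleK. Qed.

Lemma dyadic_point_shift n k i : p (n + k) (i * 2 ^ k) = p n i.
Proof.
elim: k => [|k IH]; first by rewrite addn0 muln1.
by rewrite addnS expnS mulnCA mul2n dyadic_point_double.
Qed.

Lemma dyadic_point_step n i : (i < 2 ^ n)%N ->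
  p n i \lt p n i.+1.
Proof.
elim: n i => [|n IH] i; first by rewrite ltnS leqn0 => /eqP ->.
rewrite expnS => i2; have {IH} := IH i./2; rewrite /=.
have -> : uphalf i = (if odd i then i./2.+1 else i./2) by rewrite uphalf_half; case: odd.
have i2' : (i./2 < 2 ^ n)%N by rewrite ltn_half_double -mul2n.
move=> /(_ i2') pi; have [[pf fp] _] := fP (p := (_, _)) pi.
by case: (odd i).
Qed.

Lemma dyadic_point_mono n i j : (i <= j)%N -> (j <= 2 ^ n)%N -> p n i \le p n j.
Proof.
elim: j => [|j IH]; first by rewrite leqn0 => /eqP -> _; exact: lo_refl.
rewrite leq_eqVlt => /orP[/eqP -> _|ij jn]; first exact: lo_refl.
apply: (lo_trans lin) (lo_ltW lin (dyadic_point_step jn)).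
by apply: IH => //; exact: ltnW.
Qed.

Lemma dyadic_point_le n i m j : (j <= 2 ^ m)%N -> dyadic n i <= dyadic m j ->
  p n i \le p m j.
Proof.
move=> jm; rewrite /dyadic ler_pdivrMr ?exprn_gt0// mulrAC ler_pdivlMr ?exprn_gt0//.
rewrite -!natrX -!natrM ler_nat => ij.
rewrite -(dyadic_point_shift n m i) -(dyadic_point_shift m n j) (addnC m n).
by apply: dyadic_point_mono => //; rewrite expnD mulnC leq_mul2l jm orbT.
Qed.

Lemma dyadic_point_lt n i m j : (j <= 2 ^ m)%N -> (i <= 2 ^ n)%N ->
  dyadic n i < dyadic m j -> p n i \lt p m j.
Proof.
move=> jm im; rewrite /dyadic ltr_pdivrMr ?exprn_gt0// mulrAC ltr_pdivlMr ?exprn_gt0//.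
rewrite -!natrX -!natrM ltr_nat => ij.
rewrite -(dyadic_point_shift n m i) -(dyadic_point_shift m n j) (addnC m n).
have jmn : (j * 2 ^ n <= 2 ^ (n + m))%N by rewrite expnD mulnC leq_mul2l jm orbT.
have ij' := leq_trans ij jmn.
exact: (lo_lt_le_trans lin) (dyadic_point_step ij') (dyadic_point_mono ij jmn).
Qed.

Lemma dyadic_point_locate n x : x \lt b -> exists i,
  [/\ (i < 2 ^ n)%N, p n i \le x & x \lt p n i.+1].
Proof.
move=> xb; elim: n => [|n [i [i2 ix xi]]].
  by exists 0%N; split.
pose y := e (f (p n i, p n i.+1)).
have yE : p n.+1 i.*2.+1 = y by rewrite /= odd_double /= uphalf_double.
have [yx|xy] := pselect (y \le x).
  exists i.*2.+1; split; first by rewrite expnS; lia.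
    by rewrite yE.
  by rewrite -doubleS dyadic_point_double.
exists i.*2; split; first by rewrite expnS; lia.
  by rewrite dyadic_point_double.
by rewrite yE.
Qed.

(** If e n is not reached at stage n, it is inside some interval of that stage, where
    no earlier term of the sequence remains; hence it is chosen next. *)
Lemma dyadic_point_exhaust n k : (k < n)%N -> a \lt e k -> e k \lt b ->
  exists2 i, (i <= 2 ^ n)%N & p n i = e k.
Proof.
elim: n k => [//|n IH] k; rewrite ltnS leq_eqVlt => /orP[/eqP -> {k}|kn] ak kb; last first.
  have [i i2 pe] := IH k kn ak kb; exists i.*2; first by rewrite expnS; lia.
  by rewrite dyadic_point_double.
have [i [i2 ie ei]] := dyadic_point_locate n kb.
have [pe|pe] := pselect (p n i = e n).
  by exists i.*2; [rewrite expnS; lia|rewrite dyadic_point_double].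
have ltpe := lo_le_neq_lt lin ie pe.
exists i.*2.+1; first by rewrite expnS; lia.
rewrite /= odd_double /= uphalf_double.
have [[pf fp] fmin] := fP (p := (_, _)) (dyadic_point_step i2).
have := fmin n ltpe ei; rewrite leq_eqVlt => /orP[/eqP -> //|fn].
exfalso; have [||j j2 pj] := IH _ fn.
- by apply: (lo_le_lt_trans lin) pf; exact: le_a.
- by apply: (lo_lt_le_trans lin) fp _; exact: le_b.
rewrite -pj in pf fp.
have [ji|ij] := leqP j i; first by apply: pf; apply: dyadic_point_mono => //; exact: ltnW.
by apply: fp; exact: dyadic_point_mono.
Qed.

Lemma dyadic_point_between x y : x \lt y -> exists n i,
  [/\ (i <= 2 ^ n)%N, x \lt p n i & p n i \lt y].
Proof.
move=> /dense_e[k [xk ky]].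
have [|||i i2 pi] := @dyadic_point_exhaust k.+1 k.
- by [].
- exact: (lo_le_lt_trans lin) (le_a x) xk.
- exact: (lo_lt_le_trans lin) ky (le_b y).
by exists k.+1, i; rewrite pi.
Qed.

Lemma dyadic_between (q r : R) : 0 <= r -> r <= 1 -> q < r -> exists n i,
  [/\ (i <= 2 ^ n)%N, q < dyadic n i & dyadic n i <= r].
Proof.
move=> r0 r1 qr.
have [n nqr] : exists n, (2 ^+ n)^-1 < r - q.
  have [n] : exists n : nat, 0 + n.+1%:R^-1 < r - q.
    by apply: ltr_add_invr; rewrite subr_gt0.
  rewrite add0r => nqr; exists n; apply: le_lt_trans nqr.
  rewrite lef_pV2 ?posrE ?exprn_gt0// -natrX ler_nat.
  exact: ltn_expl.
have n0 : 0 < 2 ^+ n :> R by rewrite exprn_gt0.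
have /truncn_itv/andP[ti it] : 0 <= r * 2 ^+ n by rewrite mulr_ge0// ltW.
exists n, (Num.truncn (r * 2 ^+ n)); rewrite /dyadic; split.
- rewrite -(ler_nat R) natrX; apply: le_trans ti _.
  by rewrite ler_piMl// ltW.
- rewrite ltr_pdivlMr//.
  have : 1 < (r - q) * 2 ^+ n by rewrite -ltr_pdivrMr// div1r.
  move: it; rewrite -natr1; nra.
- by rewrite ler_pdivrMr.
Qed.

Definition below x : set R :=
  [set d | exists n i, [/\ (i <= 2 ^ n)%N, p n i \le x & d = dyadic n i]].

Lemma dyadic_le1 n i : (i <= 2 ^ n)%N -> dyadic n i <= 1.
Proof.
by move=> i2; rewrite /dyadic ler_pdivrMr ?exprn_gt0// mul1r -natrX ler_nat.
Qed.

Lemma below_sup x : has_sup (below x).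
Proof.
split; first by exists (dyadic 0 0), 0%N, 0%N.
by exists 1 => _ [n [i [i2 _ ->]]]; exact: dyadic_le1.
Qed.

Lemma below_le x n i : (i <= 2 ^ n)%N -> p n i \le x -> dyadic n i <= sup (below x).
Proof.
by move=> i2 px; apply: ub_le_sup; [exact: (below_sup x).2|exists n, i].
Qed.

Lemma sup_below_le x (r : R) :
  (forall n i, (i <= 2 ^ n)%N -> p n i \le x -> dyadic n i <= r) ->
  sup (below x) <= r.
Proof.
move=> H; apply: ge_sup; first exact: (below_sup x).1.
by move=> _ [n [i [i2 px ->]]]; exact: H.
Qed.

(** Two dyadic points between x and y are needed: one bounds the first supremum from
    above, the other the second one from below. *)
Lemma sup_below_lt x y : x \lt y -> sup (below x) < sup (below y).
Proof.
move=> /dyadic_point_between[n [i [i2 xi iy]]].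
have [m [j [j2 ij jy]]] := dyadic_point_between iy.
apply: (@le_lt_trans _ _ (dyadic n i)).
  apply: sup_below_le => n' i' i2' px; rewrite leNgt; apply/negP => /ltW id.
  by apply: xi; apply: (lo_trans lin) px; exact: dyadic_point_le id.
apply: (@lt_le_trans _ _ (dyadic m j)).
  by rewrite ltNge; apply/negP => ji; apply: ij; exact: dyadic_point_le ji.
by apply: below_le => //; exact: (lo_ltW lin jy).
Qed.

Lemma sup_below_surj (r : R) : 0 <= r -> r <= 1 -> exists x, sup (below x) = r.
Proof.
move=> r0 r1.
have [x [ubx lubx]] := lubs [set y | exists n i,
  [/\ (i <= 2 ^ n)%N, dyadic n i <= r & y = p n i]].
exists x; apply/eqP; rewrite eq_le; apply/andP; split.
  apply: sup_below_le => n i i2 px; rewrite leNgt; apply/negP => ri.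
  have v1 := dyadic_le1 i2.
  have [|||m [j [j2 rj ji]]] := @dyadic_between r ((r + dyadic n i) / 2); [lra..|].
  have xj : x \le p m j.
    apply: lubx => _ [m' [j' [j2' jr' ->]]]; apply: dyadic_point_le => //.
    by apply: le_trans jr' _; exact: ltW.
  have : p m j \lt p n i by apply: dyadic_point_lt => //; lra.
  by apply; exact: (lo_trans lin) px xj.
rewrite leNgt; apply/negP => xr.
have [n [i [i2 xi ir]]] := dyadic_between r0 r1 xr.
by move: xi; apply/negP; rewrite -leNgt; apply: below_le => //; apply: ubx; exists n, i.
Qed.

End order_characterization.

(** The isomorphism maps x to the supremum of the dyadic numbers whose dyadic points
    are at most x. *)
Lemma order_isomorphic_unit_interval (R : realType) (T : Type)
    (le : T -> T -> Prop) (e : nat -> T) : linear_order le ->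
  (forall S : set T, exists u, is_lub le S u) ->
  (forall x y, ~ le y x -> exists n, ~ le (e n) x /\ ~ le y (e n)) ->
  (exists x y : T, x <> y) ->
  exists h : T -> unit_interval R, order_isomorphism le (@unit_interval_le R) h.
Proof.
move=> lin lubs dense_e [x0 [y0 xy0]].
have [b [ub _]] := lubs setT; have [a [_ lba]] := lubs set0.
have le_b x : le x b by exact: ub.
have le_a x : le a x by exact: lba.
have ab : ~ le b a.
  move=> ba; apply: xy0; apply: (lo_anti lin).
    exact: (lo_trans lin) (le_b x0) (lo_trans lin ba (le_a y0)).
  exact: (lo_trans lin) (le_b y0) (lo_trans lin ba (le_a x0)).
have [f fP] : exists f : T * T -> nat, forall p, ~ le p.2 p.1 ->
    (~ le (e (f p)) p.1 /\ ~ le p.2 (e (f p))) /\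
    forall k, ~ le (e k) p.1 -> ~ le p.2 (e k) -> (f p <= k)%N.
  have fex (p : T * T) : exists m, ~ le p.2 p.1 ->
      (~ le (e m) p.1 /\ ~ le p.2 (e m)) /\
      forall k, ~ le (e k) p.1 -> ~ le p.2 (e k) -> (m <= k)%N.
    have [lp|nlp] := pselect (le p.2 p.1); first by exists 0%N.
    by have [m mP] := first_between dense_e nlp; exists m.
  by have [f fP] := choice fex; exists f.
pose h x : R := sup (below le e a b f x).
have h01 x : `[0, 1]%classic (h x).
  rewrite /= in_itv /=; apply/andP; split.
    have -> : 0 = dyadic 0 0 :> R by rewrite /dyadic mul0r.
    by apply: below_le.
  by apply: sup_below_le => // n i i2 _; exact: dyadic_le1.
pose H x : unit_interval R := exist _ (h x) (mem_set (h01 x)).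
have hlt x y : ~ le y x -> h x < h y by exact: sup_below_lt.
have hle x y : le x y <-> h x <= h y.
  split => [xy|]; last first.
    by move=> hxy; apply: contrapT => /hlt; rewrite ltNge hxy.
  have [->//|xNy] := pselect (x = y).
  exact: ltW (hlt _ _ (lo_le_neq_lt lin xy xNy)).
have Hsurj (u : unit_interval R) : exists x, H x = u.
  have := set_valP u; rewrite /= in_itv /= => /andP[u0 u1].
  have [x hx] : exists x, h x = set_val u by exact: sup_below_surj.
  by exists x; apply: val_inj.
exists H; split; last by move=> x y; exact: hle.
have [g gP] := choice Hsurj.
exists g => // x; have ghx : h (g (H x)) = h x := congr1 set_val (gP (H x)).
by apply: (lo_anti lin); apply/hle; rewrite ghx.
Qed.


(** * First Baire class maps and F_sigma subsets of the line *)

Lemma Fsigma_sigma_algebra (T : topologicalType) (A : set T) :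
  Fsigma A -> <<s @open T >> A.
Proof.
have [s0 sD sU] := smallest_sigma_algebra [set: T] (@open T).
move=> [F clF ->]; apply: sU => n; rewrite -[F n]setCK -setTD; apply: sD.
by apply: sub_smallest; [exact: subset_refl|exact: closed_openC].
Qed.

Lemma first_baire_class_borel (S T : topologicalType) (f : S -> T) :
  first_baire_class f -> borel_map f.
Proof.
move=> bf; rewrite /borel_map.
have [s0 sD sU] := smallest_sigma_algebra [set: S] (@open S).
apply: (@smallest_sub _ (sigma_algebra [set: T]) (@open T)
  [set B | <<s @open S >> (f @^-1` B)]); last first.
  by move=> B /bf /Fsigma_sigma_algebra.
split => [|A sA|A sA] /=.
- by rewrite preimage_set0.
- by rewrite setTD preimage_setC -setTD; exact: sD.
- by rewrite preimage_bigcup; exact: sU.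
Qed.

Section unit_interval_Fsigma.
Context {R : realType}.
Implicit Types (A : set R).

Lemma Fsigma_half_line (x : R) (b : bool) : Fsigma [set` Interval (BSide b x) +oo%O].
Proof.
case: b.
  apply: closed_Fsigma; rewrite set_itvE; exact: closed_ge.
exists (fun n => [set y | x + n.+1%:R^-1 <= y]) => [n|]; first exact: closed_ge.
apply/seteqP; split => y /=; rewrite in_itv /= andbT.
  by move=> /ltr_add_invr[n xny]; exists n => //=; exact: ltW.
by move=> [n _ /=]; apply: lt_le_trans; rewrite ltrDl.
Qed.

Lemma Fsigma_half_line_opp (x : R) (b : bool) : Fsigma [set` Interval -oo%O (BSide b x)].
Proof.
case: b; last first.
  apply: closed_Fsigma; rewrite set_itvE; exact: closed_le.
exists (fun n => [set y | y <= x - n.+1%:R^-1]) => [n|]; first exact: closed_le.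
apply/seteqP; split => y /=; rewrite in_itv /=.
  by move=> /ltr_add_invr[n xny]; exists n => //=; rewrite lerBrDr ltW.
by move=> [n _ /=] /le_lt_trans; apply; rewrite ltrBlDr ltrDl.
Qed.

Lemma Fsigma_interval A : is_interval A -> Fsigma A.
Proof.
move=> /is_intervalP ->; case: (Rhull A) => l r.
have -> : [set` Interval l r] = [set` Interval l +oo%O] `&` [set` Interval -oo%O r].
  apply/seteqP; split => x /=; rewrite !itv_boundlr /= ?andbT ?bnd_simp.
    by move=> /andP[].
  by move=> [-> ->].
have FT : Fsigma [set: R] by apply: closed_Fsigma; exact: closedT.
apply: Fsigma_setI.
  case: l => [b x|[]]; first exact: Fsigma_half_line.
    by rewrite set_itvE.
  by rewrite (_ : [set` _] = set0); [exact/closed_Fsigma/closed0|rewrite set_itvE].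
case: r => [b x|[]]; first exact: Fsigma_half_line_opp.
  by rewrite (_ : [set` _] = set0); [exact/closed_Fsigma/closed0|rewrite set_itvE].
by rewrite set_itvE.
Qed.

Lemma Fsigma_unit_interval A : Fsigma A ->
  Fsigma [set u : unit_interval R | A (set_val u)].
Proof.
move=> [F clF ->]; exists (fun n => [set u : unit_interval R | F n (set_val u)]) => //.
move=> n; rewrite -[X in closed X]setCK; apply: open_closedC.
by exists (~` F n) => //; exact: closed_openC.
Qed.

Definition between (s t : R) := [set r | s <= r <= t \/ t <= r <= s].

(** A is the union over the rationals q of the set of those t for which A includes
    everything between q and t; each of these sets is an interval. *)
Lemma Fsigma_one_sided A :
  (forall t, A t -> exists2 s, s <> t & between s t `<=` A) -> Fsigma A.
Proof.
move=> hA; pose J (q : rat) := [set t | between (ratr q) t `<=` A].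
have -> : A = \bigcup_q J q.
  apply/seteqP; split => t; last first.
    by move=> [q _]; apply; rewrite /between /= !lexx !andbT; apply/orP; exact: le_total.
  move=> At; have [s st sA] := hA t At.
  have [st'|ts] : s < t \/ t < s.
    by move/eqP: st; rewrite neq_lt => /orP.
    have [q /[!in_itv]/= /andP[sq qt]] := rat_in_itvoo st'.
    exists q => // r /= rb; apply: sA; left.
    by case: rb => /andP[? ?]; apply/andP; split; lra.
  have [q /[!in_itv]/= /andP[sq qt]] := rat_in_itvoo ts.
  exists q => // r /= rb; apply: sA; right.
  by case: rb => /andP[? ?]; apply/andP; split; lra.
apply: Fsigma_bigcup => q _; apply: Fsigma_interval => x y Jx Jy z /andP[xz zy] r rz.
have [qz|zq] := lerP (ratr q) z.
  apply: Jy; left; case: rz => /andP[? ?]; apply/andP; split; lra.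
apply: Jx; right; case: rz => /andP[? ?]; apply/andP; split; lra.
Qed.

End unit_interval_Fsigma.


(** * The isomorphism theorem *)

Section isomorphism_class.
Context {R : realType} {X : metricType R} (le : X -> X -> Prop)
  (h : X -> unit_interval R) (g : unit_interval R -> X).
Hypotheses (hK : cancel h g) (gK : cancel g h)
  (h_le : forall x y, le x y <-> unit_interval_le (h x) (h y)).

Let h_lt x y : ~ le y x <-> (set_val (h x) : R) < set_val (h y).
Proof.
rewrite ltNge; split; first by move=> nyx; apply/negP => /h_le.
by move=> /negP nyx /h_le.
Qed.

Let h01 x : 0 <= (set_val (h x) : R) /\ (set_val (h x) : R) <= 1.
Proof. by have := set_valP (h x); rewrite /= in_itv /= => /andP. Qed.

Let point (t : R) : 0 <= t -> t <= 1 -> exists x, set_val (h x) = t.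
Proof.
move=> t0 t1; have t01 : t \in `[0, 1]%classic.
  by rewrite inE /= in_itv /= t0 t1.
by exists (g (exist _ t t01)); rewrite gK.
Qed.

(** Open sets of the line are countable unions of intervals with rational
    ends, and the preimage of an interval is an intersection of two rays. *)
Lemma first_baire_class_of_rays :
  (forall x, Fsigma [set z | ~ le x z]) -> (forall x, Fsigma [set z | ~ le z x]) ->
  first_baire_class h.
Proof.
move=> lower upper.
have FT : Fsigma [set: X] by exact: closed_Fsigma closedT.
have F0 : Fsigma (@set0 X) by exact: closed_Fsigma closed0.
have below t : Fsigma [set x | (set_val (h x) : R) < t].
  have [t0|t0] := ltP t 0.
    rewrite (_ : [set _ | _] = set0) //; apply/seteqP; split => // x /=.
    by have [] := h01 x; lra.
  have [t1|t1] := ltP 1 t.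
    rewrite (_ : [set _ | _] = setT) //; apply/seteqP; split => // x _ /=.
    by have [] := h01 x; lra.
  have [x <-] := point t0 t1.
  rewrite (_ : [set _ | _] = [set z | ~ le x z]) //.
  by apply/seteqP; split => z /= /h_lt.
have above t : Fsigma [set x | t < (set_val (h x) : R)].
  have [t0|t0] := ltP t 0.
    rewrite (_ : [set _ | _] = setT) //; apply/seteqP; split => // x _ /=.
    by have [] := h01 x; lra.
  have [t1|t1] := ltP 1 t.
    rewrite (_ : [set _ | _] = set0) //; apply/seteqP; split => // x /=.
    by have [] := h01 x; lra.
  have [x <-] := point t0 t1.
  rewrite (_ : [set _ | _] = [set z | ~ le z x]) //.
  by apply/seteqP; split => z /= /h_lt.
move=> _ [W oW <-].
pose I (q : rat * rat) : set R := ball (ratr q.1 : R) (ratr q.2).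
have -> : h @^-1` (set_val @^-1` W) =
    \bigcup_(q in [set q : rat * rat | I q `<=` W])
    [set x | I q (set_val (h x))].
  apply/seteqP; split => x /=; last by move=> [q qW]; exact: qW.
  move=> Wx; have [|c [r [cr crW]]] := open_subball_rat (x := set_val (h x)) oW.
    by rewrite inE.
  by exists (c, r) => //=; move: cr; rewrite inE.
apply: Fsigma_bigcup => -[c r] _; rewrite /I /=.
rewrite (_ : [set _ | _] = [set x | ratr c - ratr r < (set_val (h x) : R)] `&`
   [set x | (set_val (h x) : R) < ratr c + ratr r]); first exact: Fsigma_setI.
apply/seteqP; split => x; rewrite /= -ball_normE /= ltr_norml.
  by move=> /andP[? ?]; split; lra.
by move=> [? ?]; apply/andP; split; lra.
Qed.

Lemma inverse_first_baire_class :
  (forall W w, open W -> W w -> exists2 y, y <> w &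
    forall z, le y z /\ le z w \/ le w z /\ le z y -> W z) ->
  first_baire_class g.
Proof.
move=> nbhd W oW.
pose A := [set t : R | exists2 x, W x & set_val (h x) = t].
have -> : g @^-1` W = [set u | A (set_val u)].
  apply/seteqP; split => u /=.
    by move=> Wu; exists (g u) => //; rewrite gK.
  by move=> [x Wx /val_inj <-]; rewrite hK.
apply: Fsigma_unit_interval; apply: Fsigma_one_sided => _ [x Wx <-].
have [y yx yW] := nbhd W x oW Wx.
exists (set_val (h y)).
  by move=> /val_inj hyx; apply: yx; rewrite -(hK y) hyx hK.
move=> r rb; have [hx0 hx1] := h01 x; have [hy0 hy1] := h01 y.
have [||z zr] := @point r; [by case: rb => /andP[? ?]; lra..|].
exists z => //; apply: yW.
by case: rb; rewrite -zr => /andP[/h_le ? /h_le ?]; [left|right].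
Qed.

End isomorphism_class.

Unset Implicit Arguments.

Theorem theorem5p2 (R : realType) (X : metricType R)
    (X_continuum : continuum [set: X])
    (X_nondegenerate : nondegenerate_set [set: X])
    (X_suslinean : suslinean X)
    (X_chainable : chainable X)
    (D : nat -> seq (set X))
    (D_chain : forall n, chain (D n))
    (D_covers : forall n, covers (D n))
    (D_mesh : mesh (D n) @[n --> \oo] --> 0%:E)
    (U : set_system nat)
    (U_ultra : UltraFilter U)
    (U_nonprincipal : nonprincipal U) :
  order_isomorphic (ultrafilter_le D U) (@unit_interval_le R) /\
  exists h : X -> unit_interval R,
    order_isomorphism (ultrafilter_le D U) (@unit_interval_le R) h /\
    borel_isomorphism11 h.
Proof.
have cX := X_continuum.1.
set le := ultrafilter_le D U.
have lin : linear_order le by exact: ultrafilter_le_linear.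
have cvx (A : set X) : continuum A -> convex_for le A by exact: continuum_convex.
have uni (K K' : set X) : continuum K -> continuum K' -> connected (K `&` K').
  exact: (chain_hereditarily_unicoherent cX D_chain D_covers D_mesh).
have deco (Y : set X) : continuum Y -> nondegenerate_set Y -> decomposable Y.
  exact: suslinean_decomposable.
have [x0 [y0 [_ _ xy0]]] := X_nondegenerate.
have X0 : [set: X] !=set0 by exists x0.
have [e ed] := countable_order_dense X_continuum uni deco lin cvx X_suslinean X0.
have [h [bij_h h_le]] : exists h : X -> unit_interval R,
    order_isomorphism le (@unit_interval_le R) h.
  apply: (order_isomorphic_unit_interval R lin _ ed); last by exists x0, y0.
  by move=> S; exact: (lub_exists X_continuum deco lin cvx).
split; first by exists h.
exists h; split => //; have [g hK gK] := bij_h; exists g.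
have bh : first_baire_class h.
  apply: (first_baire_class_of_rays gK h_le) => x.
    by apply: (lower_ray_Fsigma X_continuum uni deco lin cvx); exact: ed.
  apply: (lower_ray_Fsigma X_continuum uni deco (linear_order_rev lin) _ (e := e)).
    by move=> A /cvx; exact: convex_for_rev.
  by move=> y z /ed[n [zn ny]]; exists n; split.
have bg : first_baire_class g.
  apply: (inverse_first_baire_class hK gK h_le) => W w oW Ww.
  have [y yw yW] := hull_in_open X_continuum uni deco lin cvx X_nondegenerate oW Ww.
  exists y => // z zb; apply: yW => A [cA Ay Aw].
  by case: zb => -[? ?]; [apply: (cvx A cA y z w)|apply: (cvx A cA w z y)].
by split => //; split => //; exact: first_baire_class_borel.
Qed.
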